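(* Let $k\ge1$ be an integer. For each integer $N\ge2$ let $X=X_{(N)}$ be the discrete interacting particle process with $k$ rows and parameter $q=\frac1N$ described in the context, and let $(Y(t))_{t\ge0}$ be the continuous-time interacting particle process with $k$ rows, started from $Y(0)=0$, described in the context. Then the process $(X([Nt]),t\ge0)$ converges in distribution towards the process $(Y(t),t\ge0)$ as $N$ goes to infinity.
   Context: **Notation.** $\mathbb N=\{0,1,2,\dots\}$, $[a]$ is the integer part of $a$. Configurations are families $(x^1,\dots,x^k)$ with $x^l=(x^l_1,\dots,x^l_{[\frac{l+1}{2}]})$ having non-negative integer entries, weakly decreasing, and consecutive rows interlaced: $x^{l-1}\preceq x^l$, where for $x,y\in\mathbb R^n$, $x\preceq y$ means $x_n\le y_n\le x_{n-1}\le\cdots\le x_1\le y_1$, and for $x\in\mathbb R^n$, $y\in\mathbb R^{n+1}$, $x\preceq y$ means $y_{n+1}\le x_n\le y_n\le\cdots\le x_1\le y_1$. **Process $X$ with parameter $q\in(0,1)$.** Let $\xi^i_j(n+\frac12)$ ($n\ge0$) and $\xi^i_j(n)$ ($n\ge1$), for $1\le i\le k$, $1\le j\le[\frac{i+1}{2}]$, be independent random variables with law $\mathbb P(\xi=x)=(1-q)q^x$, $x\in\mathbb N$. The process $X(t)=(X^1(t),\dots,X^k(t))$, $t\in\{0,\frac12,1,\dots\}$, starts at $X(0)=0$. For $n\ge 0$, with the convention $X_0^{l-1}(\cdot)=+\infty$, rows are updated successively for $l=1,\dots,k$. *Time $n+\frac12$.* For $1\le i\le[\frac{l+1}{2}]$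 put $\tilde X_i^l(n)=\min\big(X_i^l(n),X_{i-1}^{l-1}(n+\tfrac12)\big)$. For $1\le i\le[\frac l2]$, $X_i^l(n+\frac12)=\max\big(X_i^{l-1}(n),\tilde X_i^l(n)-\xi_i^l(n+\frac12)\big)$. If $l$ is odd, $X^l_{\frac{l+1}{2}}(n+\frac12)=\tilde X^l_{\frac{l+1}{2}}(n)$. *Time $n+1$.* For $1\le i\le[\frac l2]$ put $\tilde X_i^l(n+\frac12)=\max\big(X_i^{l-1}(n+1),X_i^l(n+\frac12)\big)$ and $X_i^l(n+1)=\min\big(X_{i-1}^{l-1}(n+\frac12),\tilde X_i^l(n+\frac12)+\xi_i^l(n+1)\big)$. If $l$ is odd, $X^l_{\frac{l+1}{2}}(n+1)=\min\big(\big|X^l_{\frac{l+1}{2}}(n+\frac12)+\xi^l_{\frac{l+1}{2}}(n+1)-\xi^l_{\frac{l+1}{2}}(n+\frac12)\big|,\,X^{l-1}_{\frac{l-1}{2}}(n+\frac12)\big)$. **Process $Y$.** $Y^i_j(t)$ is the position of the particle labeled $(i,j)$, $1\le i\le k$, $1\le j\le[\frac{i+1}{2}]$, and $Y(0)=0$. Every particle tries to jump to the left by one and to the right by one after independent exponentially distributed waiting times with mean $1$ (all clocks, for all particles and both directions, are independent and renewed). When particle $(i,j)$ wants to jump to the right at time $t$: (R1) if $i,j\ge2$ and $Y^i_j(t^-)=Y^{i-1}_{j-1}(t^-)$, nothing moves; (R2) otherwise particles $(i,j),(i+1,j),\dots,(i+l,j)$ all jump to the right by one, where $l$ is the largest integer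 (with $i+l\le k$) such that $Y^{i+l}_j(t^-)=Y^i_j(t^-)$. When particle $(i,j)$ wants to jump to the left at time $t$: (L1) if $i$ is odd, $j=(i+1)/2$ and $Y^i_j(t^-)=0$, then the particle is reflected and everything happens as if it were trying to jump to the right by one (rules R1, R2); (L2) if $i$ is odd, $j=(i+1)/2$ and $Y^i_j(t^-)\ge1$, then $Y^i_j(t)=Y^i_j(t^-)-1$; (L3) if $i$ is even or $j\ne(i+1)/2$, and $Y^i_j(t^-)=Y^{i-1}_j(t^-)$, nothing moves; (L4) if $i$ is even or $j\neq(i+1)/2$, and $Y^i_j(t^-)>Y^{i-1}_j(t^-)$, then particles $(i,j),(i+1,j+1),\dots,(i+l,j+l)$ all jump to the left by one, where $l$ is the largest integer (with $i+l\le k$) such that $Y^{i+l}_{j+l}(t^-)=Y^i_j(t^-)$. *)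

(* Defs.v *)
From HB Require Import structures.
From mathcomp Require Import all_boot all_order all_algebra finmap.
From mathcomp Require Import all_classical all_reals all_analysis.

Set Implicit Arguments.
Unset Strict Implicit.
Unset Printing Implicit Defensive.

Import Order.TTheory GRing.Theory Num.Theory.
Import numFieldNormedType.Exports.

Local Open Scope classical_set_scope.
Local Open Scope ring_scope.

(* Paths are total functions on R; the normalisation [path_neg] on negative
   times makes this type the set of cadlag functions on [0, +oo[. *)
Record cadlag (R : realType) (E : topologicalType) := Cadlag {
  path :> R -> E;
  path_neg : forall t, t <= 0 -> path t = path 0;
  path_right : forall t, 0 <= t -> path s @[s --> t^'+] --> path t;
  path_left : forall t, 0 < t -> exists l : E, path s @[s --> t^'-] --> l }.

HB.instance Definition _ (R : realType) (E : topologicalType) :=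
  gen_eqMixin (cadlag R E).
HB.instance Definition _ (R : realType) (E : topologicalType) :=
  gen_choiceMixin (cadlag R E).

(* Strictly increasing maps of [0, +oo[ onto itself (hence continuous). *)
Definition time_change (R : realType) (lam : R -> R) : Prop :=
  (forall s t, 0 <= s -> s < t -> lam s < lam t) /\
  lam @` [set s | 0 <= s] = [set s | 0 <= s].

Section Skorokhod.
Context {R : realType} {E : uniformType}.
Local Open Scope relation_scope.

(* The J1 uniformity: two paths are close when, after a small deformation of
   time, they are uniformly close on a long time interval.  The induced
   convergence is that of Ethier-Kurtz, Proposition 3.5.3(c). *)
Definition skorokhod_close (T e : R) (A : set (E * E)) :
    set (cadlag R E * cadlag R E) :=
  [set fg : cadlag R E * cadlag R E | exists2 lam : R -> R, time_change lam &
    forall s : R, 0 <= s -> s <= T ->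
      `|lam s - s| < e /\ A (fg.1 s, fg.2 (lam s))].

Definition skorokhod_entourage : set_system (cadlag R E * cadlag R E) :=
  filter_from [set p : R * R * set (E * E) | 0 < p.1.2 /\ entourage p.2]
    (fun p => skorokhod_close p.1.1 p.1.2 p.2).

Lemma time_change_ge0 (lam : R -> R) s : time_change lam -> 0 <= s -> 0 <= lam s.
Proof.
move=> [_ lamE] s0.
have : (lam @` [set s | 0 <= s]) (lam s) by exists s.
by rewrite lamE.
Qed.

Lemma time_change_onto (lam : R -> R) u :
  time_change lam -> 0 <= u -> exists2 s, 0 <= s & lam s = u.
Proof.
move=> [_ lamE] u0.
have : [set s : R | 0 <= s] u by [].
by rewrite -lamE => -[s s0 <-]; exists s.
Qed.

Lemma time_change_le (lam : R -> R) s t :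
  time_change lam -> 0 <= s -> s <= t -> lam s <= lam t.
Proof. by move=> [h _] s0; rewrite le_eqVlt => /predU1P[->//|/h/ltW]; exact. Qed.

Lemma time_change_lt (lam : R -> R) s t :
  time_change lam -> 0 <= t -> lam s < lam t -> s < t.
Proof.
move=> lamP t0; apply: contraTT; rewrite -!leNgt => ts.
exact: time_change_le.
Qed.

Lemma time_change_id : time_change (id : R -> R).
Proof. by split=> //; rewrite image_id. Qed.

Lemma time_change_comp (lam mu : R -> R) :
  time_change lam -> time_change mu -> time_change (mu \o lam).
Proof.
move=> lamP muP; split=> [s t s0 st|].
  by apply: muP.1; [exact: time_change_ge0|exact: lamP.1].
by rewrite -image_comp lamP.2 muP.2.
Qed.

Lemma time_change_inv (lam : R -> R) : time_change lam ->
  exists2 mu, time_change mu & forall s, 0 <= s -> lam (mu s) = s.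
Proof.
move=> lamP.
pose mu s := xget 0 [set u | 0 <= u /\ lam u = s].
have muP s : 0 <= s -> 0 <= mu s /\ lam (mu s) = s.
  move=> s0; have [u u0 us] := time_change_onto lamP s0.
  by rewrite /mu; case: xgetP => [v -> //|/(_ u)]; case; split.
exists mu => [|s /muP[]//]; split=> [s t s0 st|].
  have t0 : 0 <= t by rewrite (le_trans s0)// ltW.
  apply: (time_change_lt lamP); first exact: (muP _ t0).1.
  by rewrite (muP _ s0).2 (muP _ t0).2.
apply/seteqP; split=> [_ [s /= + <-]|u /=].
  by move=> /muP[].
move=> u0; have l0 := time_change_ge0 lamP u0.
exists (lam u) => //.
have [m0 mE] := muP _ l0.
apply/eqP; rewrite eq_le; apply/andP; split; rewrite leNgt; apply/negP.
  by move=> /(lamP.1 _ _ u0); rewrite mE ltxx.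
by move=> /(lamP.1 _ _ m0); rewrite mE ltxx.
Qed.

Lemma skorokhod_close_sub (T T' e e' : R) (A A' : set (E * E)) :
  T <= T' -> e' <= e -> A' `<=` A ->
  skorokhod_close T' e' A' `<=` skorokhod_close T e A.
Proof.
move=> TT ee AA fg [lam lamP h]; exists lam => // s s0 sT.
have [h1 h2] := h s s0 (le_trans sT TT).
by split; [exact: lt_le_trans ee|exact: AA].
Qed.

Lemma skorokhod_entourage_filter : Filter skorokhod_entourage.
Proof.
apply: filter_from_filter.
  by exists (0, 1, setT) => /=; split=> //; exact: filterT.
move=> [[T e] A] [[T' e'] A'] /= [e0 AE] [e0' AE'].
exists (Num.max T T', Num.min e e', A `&` A') => /=.
  by split; [rewrite lt_min e0|exact: filterI].
move=> fg h; split; apply: skorokhod_close_sub h => //=.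
- by rewrite le_max lexx.
- by rewrite ge_min lexx.
- by rewrite le_max lexx orbT.
- by rewrite ge_min lexx orbT.
Qed.

Lemma skorokhod_entourage_diagonal A :
  skorokhod_entourage A -> diagonal `<=` A.
Proof.
move=> [[[T e] B] /= [e0 BE] BA] [f g]; rewrite /diagonal /= => <-.
apply: BA; exists id => [|s s0 sT] /=; first exact: time_change_id.
by rewrite subrr normr0; split=> //; exact: entourage_refl.
Qed.

Lemma skorokhod_entourage_inv A :
  skorokhod_entourage A -> skorokhod_entourage A^-1.
Proof.
move=> [[[T e] B] /= [e0 BE] BA]; exists (T + e, e, B^-1) => /=.
  by split=> //; exact: entourage_inv.
move=> [f g] [lam lamP /= h]; apply: BA => /=.
have [mu muP muK] := time_change_inv lamP; exists mu => // s s0 sT /=.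
have m0 := time_change_ge0 muP s0.
have mT : mu s <= T + e.
  have T0 : 0 <= T by exact: le_trans sT.
  have Te0 : 0 <= T + e by rewrite addr_ge0// ltW.
  apply/ltW/(time_change_lt lamP) => //; rewrite muK//.
  apply: le_lt_trans sT _; have [+ _] := h _ Te0 (lexx _).
  by rewrite ltr_distl => /andP[+ _]; rewrite addrK.
by have := h _ m0 mT; rewrite muK// distrC.
Qed.

Lemma skorokhod_entourage_split A : skorokhod_entourage A ->
  exists2 B, skorokhod_entourage B & B \; B `<=` A.
Proof.
move=> [[[T e] B] /= [e0 BE] BA].
have e20 : 0 < e / 2 by rewrite divr_gt0.
exists (skorokhod_close (T + e / 2) (e / 2) (split_ent B)).
  by exists (T + e / 2, e / 2, split_ent B) => //=; split.
move=> [f g] /= [h [lam lamP /= fh] [mu muP /= hg]]; apply: BA => /=.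
exists (mu \o lam) => [|s s0 sT] /=; first exact: time_change_comp.
have sT' : s <= T + e / 2 by rewrite (le_trans sT)// lerDl ltW.
have [le fhs] := fh s s0 sT'.
have lT : lam s <= T + e / 2.
  move: le; rewrite ltr_distl => /andP[_ /ltW l1].
  by rewrite (le_trans l1)// lerD2r.
have [me hgs] := hg _ (time_change_ge0 lamP s0) lT.
split; last exact: (entourage_split (h (lam s))).
rewrite (_ : mu (lam s) - s = (mu (lam s) - lam s) + (lam s - s)).
  by rewrite (le_lt_trans (ler_normD _ _))// (splitr e) ltrD.
by rewrite addrA subrK.
Qed.

HB.instance Definition _ := isUniform.Build (cadlag R E)
  skorokhod_entourage_filter skorokhod_entourage_diagonal
  skorokhod_entourage_inv skorokhod_entourage_split.

End Skorokhod.

Section StepPath.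
Context {R : realType} {E : topologicalType}.
Variables (N : nat) (u : nat -> E).

Definition step_fun (t : R) : E := u (Num.truncn (N%:R * t)).

Lemma truncn_between (m : nat) (x : R) :
  m%:R <= x -> x < m.+1%:R -> Num.truncn x = m.
Proof. by move=> h1 h2; apply/eqP; rewrite truncn_eq ?h1// (le_trans _ h1). Qed.

Lemma step_neg t : t <= 0 -> step_fun t = step_fun 0.
Proof.
move=> t0; rewrite /step_fun mulr0 truncn0; congr u.
by apply/eqP; rewrite -leqn0 leqNgt truncn_gt_nat -ltNge
  (le_lt_trans _ ltr01)// mulr_ge0_le0.
Qed.

Lemma step_right t : 0 <= t -> step_fun s @[s --> t^'+] --> step_fun t.
Proof.
move=> t0; apply: cvg_near_cst.
have Nt : 0 <= N%:R * t by rewrite mulr_ge0.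
have [N0|N0] := posnP N.
  by apply: nearW => s; rewrite /step_fun N0 !mul0r.
have N0' : 0 < N%:R :> R by rewrite ltr0n.
have /andP[t1 t2] := truncn_itv Nt.
have t3 : t < (Num.truncn (N%:R * t)).+1%:R / N%:R.
  by rewrite ltr_pdivlMr// mulrC.
near=> s; rewrite /step_fun; congr u; apply: truncn_between.
  by rewrite (le_trans t1)// ler_pM2l.
rewrite mulrC -ltr_pdivlMr//; near: s; exact: nbhs_right_lt.
Unshelve. all: by end_near. Qed.

Lemma step_left t : 0 < t ->
  exists l : E, step_fun s @[s --> t^'-] --> l.
Proof.
move=> t0.
have [N0|N0] := posnP N.
  exists (u 0); apply: cvg_near_cst; apply: nearW => s.
  by rewrite /step_fun N0 mul0r truncn0.
have N0' : 0 < N%:R :> R by rewrite ltr0n.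
have Nt : 0 < N%:R * t by rewrite mulr_gt0.
have [m m1 m2] : exists2 m : nat, m%:R < N%:R * t & N%:R * t <= m.+1%:R.
  have /andP[t1 t2] := truncn_itv (ltW Nt).
  move: t1; rewrite le_eqVlt => /predU1P[tE|t1]; last first.
    by exists (Num.truncn (N%:R * t)) => //; exact: ltW.
  move: tE Nt; case: (Num.truncn _) => [|j] <-; first by rewrite ltxx.
  by exists j; rewrite ?ltr_nat.
exists (u m); apply: cvg_near_cst.
have t3 : m%:R / N%:R < t by rewrite ltr_pdivrMr// mulrC.
near=> s; rewrite /step_fun; congr u; apply: truncn_between.
  by rewrite mulrC -ler_pdivrMr//; apply/ltW; near: s; exact: nbhs_left_gt.
by rewrite (lt_le_trans _ m2)// ltr_pM2l.
Unshelve. all: by end_near. Qed.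

Definition step_path : cadlag R E := Cadlag step_neg step_right step_left.

End StepPath.

Definition mutually_independent d (T : measurableType d) (R : realType)
    (P : probability T R) d' (T' : measurableType d') (I : choiceType)
    (X : I -> {RV P >-> T'}) : Prop :=
  forall (J : {fset I}) (B : I -> set T'), (forall i, measurable (B i)) ->
    P (\bigcap_(i in [set` J]) (X i @^-1` B i)) =
    (\prod_(i <- J) P (X i @^-1` B i))%E.

Definition cvg_in_distribution (R : realType) (S : topologicalType)
    (d : nat -> measure_display) (T : forall N, measurableType (d N))
    (P : forall N, probability (T N) R) (X : forall N, T N -> S)
    d' (T' : measurableType d') (P' : probability T' R) (Y : T' -> S) : Prop :=
  forall F : S -> R, continuous F -> (exists M, forall x, `|F x| <= M) ->
    ('E_(P N)[F \o X N] @[N --> \oo] --> 'E_P'[F \o Y])%E.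

Definition is_label (k i j : nat) : bool :=
  (1 <= i <= k)%N && (1 <= j <= i.+1./2)%N.

Definition label (k : nat) : Type :=
  {p : 'I_k.+1 * 'I_k.+1 | is_label k p.1 p.2}.
HB.instance Definition _ k := Finite.on (label k).

Definition row k (p : label k) : nat := (val p).1.
Definition col k (p : label k) : nat := (val p).2.

(* [config k] carries no interlacing condition: it is preserved by the
   dynamics below, which start from 0. *)
Definition config (k : nat) : Type := {ffun label k -> nat}.
HB.instance Definition _ k := Choice.on (config k).

Definition config0 k : config k := [ffun => 0%N].

(* The entry of index [j] in row [i]; the value 0 outside the labels is
   never used. *)
Definition entry k (f : label k -> nat) (i j : nat) : nat :=
  if [pick p : label k | (row p == i) && (col p == j)] is Some p
  then f p else 0%N.

(* [xi (p, n, false)] is the variable attached to [p] at time n + 1/2 and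
   [xi (p, n, true)] the one at time n + 1. *)
Definition noise (k : nat) : Type := (label k * nat * bool)%type -> nat.

Section DiscreteProcess.
Context (k : nat).
Local Open Scope nat_scope.

(* min(v, prev_(i-1)) with the convention prev_0 = +oo *)
Definition cap (prev : nat -> nat) (i v : nat) : nat :=
  if i <= 1 then v else minn v (prev i.-1).

(* Row [l] at time n + 1/2, given the configuration [x] at time n and the
   variables [a] of time n + 1/2.  The truncated subtraction is harmless
   because of the maximum with a natural number. *)
Fixpoint half_row (x a : nat -> nat -> nat) (l : nat) : nat -> nat :=
  if l is l'.+1 then fun i =>
    let xt := cap (half_row x a l') i (x l i) in
    if i <= l./2 then maxn (x l' i) (xt - a l i) else xt
  else fun _ => 0.

(* Row [l] at time n + 1, given the configuration [h] at time n + 1/2 and the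
   variables [a] of time n + 1/2 and [b] of time n + 1.  The index i > l./2
   occurs only for l odd and i = (l + 1) / 2. *)
Fixpoint full_row (h a b : nat -> nat -> nat) (l : nat) : nat -> nat :=
  if l is l'.+1 then fun i =>
    if i <= l./2 then cap (h l') i (maxn (full_row h a b l' i) (h l i) + b l i)
    else cap (h l') i `|(h l i + b l i)%:Z - (a l i)%:Z|
  else fun _ => 0.

Definition X_half_step (xi : noise k) (n : nat) (x : config k) : config k :=
  [ffun p => half_row (entry x) (entry (fun q => xi (q, n, false)))
               (row p) (col p)].

Definition X_full_step (xi : noise k) (n : nat) (h : config k) : config k :=
  [ffun p => full_row (entry h) (entry (fun q => xi (q, n, false)))
               (entry (fun q => xi (q, n, true))) (row p) (col p)].

Fixpoint X (xi : noise k) (n : nat) : config k :=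
  if n is m.+1 then X_full_step xi m (X_half_step xi m (X xi m))
  else config0 k.

End DiscreteProcess.

Section ContinuousProcess.
Context (k : nat).
Local Open Scope nat_scope.

(* By interlacing, the particles (i + m, j) for m <= right_reach y i j are all
   at the same position, and likewise for (i + m, j + m) and left_reach. *)
Definition right_reach (y : config k) (i j : nat) : nat :=
  \max_(l < k.+1 | is_label k (i + l) j && (entry y (i + l) j == entry y i j)) l.

Definition left_reach (y : config k) (i j : nat) : nat :=
  \max_(l < k.+1 |
      is_label k (i + l) (j + l) && (entry y (i + l) (j + l) == entry y i j)) l.

Definition jump_right (p : label k) (y : config k) : config k :=
  let i := row p in let j := col p in
  if [&& 2 <= i, 2 <= j & entry y i j == entry y i.-1 j.-1] then y
  else [ffun q => if (i <= row q <= i + right_reach y i j) && (col q == j)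
                  then (y q).+1 else y q].

Definition jump_left (p : label k) (y : config k) : config k :=
  let i := row p in let j := col p in
  if odd i && (j == i.+1./2) then
    if entry y i j == 0 then jump_right p y
    else [ffun q => if q == p then (y q).-1 else y q]
  else if entry y i j == entry y i.-1 j then y
  else [ffun q =>
          if (i <= row q <= i + left_reach y i j) && (col q + i == row q + j)
          then (y q).-1 else y q].

(* A clock is a particle and a direction: [true] for right, [false] for left. *)
Definition clock : Type := (label k * bool)%type.

Definition jump (c : clock) : config k -> config k :=
  if c.2 then jump_right c.1 else jump_left c.1.

Local Open Scope ring_scope.
Context {R : realType}.

(* Time of the (n+1)-st ring of [c], from its successive waiting times. *)
Definition ring_time (tau : clock * nat -> R) (c : clock) (n : nat) : R :=
  \sum_(m < n.+1) tau (c, m : nat).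

(* [y] starts at 0, is constant between the rings, and y(t) is obtained from
   y(t^-) by the attempted jump when a clock rings at time t. *)
Definition driven_by (tau : clock * nat -> R) (y : R -> config k) : Prop :=
  [/\ y 0 = config0 k,
      forall s t, 0 <= s -> s <= t ->
        (forall c n, ~ (s < ring_time tau c n /\ ring_time tau c n <= t)) ->
        y t = y s
    & forall c n, \forall s \near (ring_time tau c n)^'-,
        y (ring_time tau c n) = jump c (y s)].

End ContinuousProcess.

(* Main.v *)
Require Import Defs.
From HB Require Import structures.
From mathcomp Require Import all_boot all_order all_algebra finmap.
From mathcomp Require Import all_classical all_reals all_analysis.
From mathcomp Require Import measurable_realfun.
From mathcomp Require Import zify ring lra.

Set Implicit Arguments.
Unset Strict Implicit.
Unset Printing Implicit Defensive.

Import Order.TTheory GRing.Theory Num.Theory.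
Import numFieldNormedType.Exports.

Local Open Scope classical_set_scope.
Local Open Scope ring_scope.

(** The two processes can be driven by the same clocks.  In the limit process
    every clock rings after independent exponential waiting times.  In the
    discrete process the variables attached to one particle and one half of the
    time steps are independent with law (1 - q) q^x.  If x is read as a number
    of rings in the step, then the numbers of steps between successive rings are
    independent with law q (1 - q)^j, and conversely.  This is the law of the
    integer part of [tau / a] for [tau] exponential, as soon as
    [exp (- a) = 1 - q].  So the discrete process with parameter [q = 1 / N] is,
    with exactly its own law, a function of the waiting times of the limit
    process, measured in the mesh [a = - ln (1 - 1 / N)], which is equivalent to
    [1 / N] ([count_string_prob], [geometric_string_prob],
    [expectation_same_noise]).

    After this coupling the convergence is almost sure.  Up to a fixed time only
    finitely many clocks ring, and almost surely at distinct times
    ([distinct_rings_ae]: an exponential variable avoids any value given by the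
    others).  For [N] large these rings fall into distinct steps, in the same
    order.  A step without ring does not move the discrete process
    ([X_step_id]), and a step with one ring performs exactly the jump of the
    limit process ([X_step_jump]), because both keep the configuration
    interlaced.  Hence the two trajectories coincide up to a time change which
    sends each ring time to the end of the step of that ring ([trajectory_eq]).
    These instants are at distance O(1 / N), and a sum of small tents is such a
    time change ([tent_change_time]), so the paths converge in the Skorokhod
    topology ([coupled_path_cvg]).

    Bounded convergence then gives the convergence of expectations.  A continuous
    functional of a discrete path is a limit of functions of finitely many noise
    variables, which have countably many values; this gives measurability and
    the equality of expectations from the probabilities of finite strings.  The
    functional of the limit path is only known to be almost surely a limit of
    measurable functions, and the integral does not distinguish it from a
    measurable one ([ae_eq_integral_any]). *)

(* [matrix] has its own [row] and [col]. *)
Local Notation row := Defs.row.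
Local Notation col := Defs.col.

(** * One step of the discrete process with at most one ring *)
Section Rows.
Context (k : nat).
Local Open Scope nat_scope.
Implicit Types x a b e h : nat -> nat -> nat.

(** Without the guards the default entry 0 outside the array would bound the
    first and last entries of the rows. *)
Definition interlaced x : Prop := forall i j, is_label k i j ->
  (is_label k i.-1 j -> x i.-1 j <= x i j) /\
  (is_label k i.-1 j.-1 -> x i j <= x i.-1 j.-1).

Lemma interlaced_up x i j : interlaced x -> is_label k i j ->
  is_label k i.+1 j -> x i j <= x i.+1 j.
Proof. by move=> H h1 h2; case: (H _ _ h2) => + _; apply. Qed.

Lemma interlaced_diag x i j : interlaced x -> is_label k i j ->
  is_label k i.+1 j.+1 -> x i.+1 j.+1 <= x i j.
Proof. by move=> H h1 h2; case: (H _ _ h2) => _; apply. Qed.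

Lemma column_le x i j m : interlaced x -> is_label k i j ->
  is_label k (i + m) j -> x i j <= x (i + m) j.
Proof.
move=> H h1; elim: m => [|m IH]; first by rewrite addn0.
rewrite addnS => h2.
have h3 : is_label k (i + m) j by move: h1 h2; rewrite /is_label; lia.
exact: leq_trans (IH h3) (interlaced_up H h3 h2).
Qed.

Lemma diagonal_ge x i j m : interlaced x -> is_label k i j ->
  is_label k (i + m) (j + m) -> x (i + m) (j + m) <= x i j.
Proof.
move=> H h1; elim: m => [|m IH]; first by rewrite !addn0.
rewrite !addnS => h2.
have h3 : is_label k (i + m) (j + m) by move: h1 h2; rewrite /is_label; lia.
exact: leq_trans (interlaced_diag H h3 h2) (IH h3).
Qed.

(** The entries pushed by a jump of (i0, j0) to the right.  In an interlaced
    array a column is nondecreasing, so those equal to the entry (i0, j0) follow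
    it without gap.  The last clause is the block by the upper-left neighbour. *)
Definition right_moves x i0 j0 l i : bool :=
  [&& i == j0, i0 <= l, x l i == x i0 j0 &
      ~~ [&& 2 <= i0, 2 <= j0 & x i0 j0 == x i0.-1 j0.-1]].

(** Same for a jump to the left, along the diagonal of (i0, j0), which is
    nonincreasing. *)
Definition left_moves x i0 j0 l i : bool :=
  [&& i0 <= l, i + i0 == l + j0, x l i == x i0 j0 & x i0 j0 != x i0.-1 j0].

Lemma half_row_id x a l i : interlaced x -> is_label k l i ->
  (forall l i, is_label k l i -> i <= l./2 -> a l i = 0) ->
  half_row x a l i = x l i.
Proof.
move=> H + a0; elim: l i => [|l IH] i hl; first by move: hl; rewrite /is_label.
have hd : 1 < i -> half_row x a l i.-1 = x l i.-1 /\ x l.+1 i <= x l i.-1.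
  move=> i1; have h : is_label k l i.-1.
    by move: hl i1; rewrite /is_label; case: i => [|[|i]]//=; lia.
  by split; [exact: IH|exact: (H _ _ hl).2].
have -> : half_row x a l.+1 i =
    let xt := cap (half_row x a l) i (x l.+1 i) in
    if i <= (l.+1)./2 then maxn (x l i) (xt - a l.+1 i) else xt by [].
have -> /= : cap (half_row x a l) i (x l.+1 i) = x l.+1 i.
  rewrite /cap; case: leqP => // /hd [-> ?]; exact/minn_idPl.
case: leqP => // il; rewrite a0//.
have h : is_label k l i by move: hl il; rewrite /is_label /=; lia.
by rewrite subn0; apply/maxn_idPr; exact: (H _ _ hl).1.
Qed.

(** The cap by the new row above hands the decrease down the diagonal: an entry
    that touched its upper-left neighbour has to follow it.  The bound on [j0]
    excludes the particle at the wall, whose left noise acts in the second half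
    of the step. *)
Lemma half_row_left x a i0 j0 l i : interlaced x -> is_label k l i ->
  is_label k i0 j0 -> j0 <= i0./2 ->
  (forall l i, is_label k l i -> a l i = ((l == i0) && (i == j0))) ->
  half_row x a l i = x l i - left_moves x i0 j0 l i.
Proof.
move=> H + h0 j0i aE.
have h0' : is_label k i0.-1 j0.
  by move: h0 j0i; rewrite /is_label; case: (i0) => // n; lia.
have x0 := (H _ _ h0).1 h0'.
elim: l i => [|l IH] i hl; first by move: hl; rewrite /is_label.
have -> : half_row x a l.+1 i =
    let xt := cap (half_row x a l) i (x l.+1 i) in
    if i <= (l.+1)./2 then maxn (x l i) (xt - a l.+1 i) else xt by [].
have E1 : cap (half_row x a l) i (x l.+1 i) =
    x l.+1 i - [&& left_moves x i0 j0 l.+1 i & i0 <= l].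
  rewrite /cap; case: leqP => i1.
    have -> : left_moves x i0 j0 l.+1 i && (i0 <= l) = false.
      apply/negP => /andP[/and4P[_ /eqP e _ _] h1].
      by move: hl h0 i1 e; rewrite /is_label; lia.
    by rewrite subn0.
  have h : is_label k l i.-1.
    by move: hl i1; rewrite /is_label; case: (i) => [|[|n]]//=; lia.
  rewrite IH//; have := (H _ _ hl).2 h; rewrite /left_moves /=.
  move: hl h i1; case: i => [|i]//= hl h i1.
  rewrite -(addn1 i) -(addn1 l) (addnAC i) (addnAC l) eqn_add2r !addn1.
  case il : (i0 <= l); last by lia.
  rewrite (leqW il) /=.
  case e : (i + i0 == l + j0) => /=; last by lia.
  case: (x i0 j0 != x i0.-1 j0); rewrite ?andbF; last by lia.
  have : x l i <= x i0 j0.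
    have [m El] : exists m, l = i0 + m by exists (l - i0); lia.
    have Ei : i = j0 + m by lia.
    rewrite El Ei; apply: diagonal_ge => //.
    by rewrite -El -Ei.
  rewrite !andbT; lia.
rewrite E1 /=.
have [h|h] := boolP (is_label k l i); last first.
  have -> : i <= uphalf l = false.
    by apply/negbTE; move: hl h; rewrite /is_label /=; lia.
  move: E1 => _; rewrite /left_moves.
  case: (leqP i0 l) => i0l; first by rewrite andbT.
  rewrite andbF; suff -> : i + i0 == l.+1 + j0 = false by rewrite andbF.
  by apply/negbTE; move: hl h h0 j0i i0l; rewrite /is_label; lia.
have xu := (H _ _ hl).1 h.
have -> : i <= uphalf l by move: h; rewrite /is_label; lia.
rewrite aE//.
case: (ltnP l i0) => i0l.
  rewrite andbF subn0.
  have [e|e] := eqVneq l.+1 i0; last first.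
    have -> : left_moves x i0 j0 l.+1 i = false by rewrite /left_moves; lia.
    by move: xu => /=; lia.
  rewrite /left_moves -e leqnn (addnC i) eqn_add2l /=.
  have [->|_] /= := eqVneq i j0; last by move: xu => /=; lia.
  rewrite eqxx /=; subst i0; move: x0 xu => /=; case: (i == j0) => //=; lia.
have -> : (l.+1 == i0) && (i == j0) = false by lia.
rewrite andbT subn0; apply/maxn_idPr.
case L: (left_moves x i0 j0 l.+1 i); rewrite /= ?subn0 ?subn1//.
move: L => /and4P[_ /eqP e1 /eqP e2 e3].
suff : x l i < x l.+1 i by lia.
rewrite e2.
have [m El] : exists m, l = i0.-1 + m by exists (l - i0.-1); lia.
have Ei : i = j0 + m by move: h0; rewrite /is_label; lia.
have : x l i <= x i0.-1 j0.
  by rewrite El Ei; apply: diagonal_ge => //; rewrite -El -Ei.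
move: x0 e3; lia.
Qed.

(** The maximum with the new row above hands the increase down the column.  The
    cap never stops a pushed entry: the entry (i0, j0) is strictly below its
    upper-left neighbour, and this strict inequality persists downwards, since
    the pushed entries are equal and the column on their left is nondecreasing.
    Only the effective increment [e] matters, which covers three cases: no noise
    ([on = false]), a right noise, and a left noise reflected at the wall, where
    `|0 - 1| = 1. *)
Lemma full_row_right h a b e (on : bool) i0 j0 l i :
  interlaced h -> is_label k l i -> is_label k i0 j0 ->
  (forall l i, is_label k l i ->
     if i <= l./2 then b l i = e l i
     else `|(h l i + b l i)%:Z - (a l i)%:Z| = h l i + e l i) ->
  (forall l i, is_label k l i -> e l i = [&& on, l == i0 & i == j0]) ->
  full_row h a b l i = h l i + (on && right_moves h i0 j0 l i).
Proof.
move=> H + h0 bE eE; elim: l i => [|l IH] i hl.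
  by move: hl; rewrite /is_label.
have -> : full_row h a b l.+1 i =
  if i <= (l.+1)./2
  then cap (h l) i (maxn (full_row h a b l i) (h l.+1 i) + b l.+1 i)
  else cap (h l) i `|(h l.+1 i + b l.+1 i)%:Z - (a l.+1 i)%:Z| by [].
have hd : 1 < i -> is_label k l i.-1 /\ h l.+1 i <= h l i.-1.
  move=> i1; have h' : is_label k l i.-1.
    by move: hl i1; rewrite /is_label; case: i => [|[|i]]//=; lia.
  by split => //; exact: (H _ _ hl).2.
have -> : (if i <= (l.+1)./2
  then cap (h l) i (maxn (full_row h a b l i) (h l.+1 i) + b l.+1 i)
  else cap (h l) i `|(h l.+1 i + b l.+1 i)%:Z - (a l.+1 i)%:Z|) =
  cap (h l) i (h l.+1 i + [|| [&& on, l.+1 == i0 & i == j0] |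
     [&& on, right_moves h i0 j0 l i & h l.+1 i == h l i]]).
  have := bE _ _ hl; have := eE _ _ hl.
  case: leqP => i2 E1 E2.
    have hl' : is_label k l i by move: hl i2; rewrite /is_label /=; lia.
    have hup := (H _ _ hl).1 hl'.
    rewrite E2 E1 IH//; congr cap; rewrite /right_moves.
    move: hup => /=; move: (h l i) (h l.+1 i) => u v.
    case: (on) => //=; last by lia.
    case: (i == j0) => /=; rewrite ?andbF/=; last by lia.
    rewrite !andbT; case: (u == h i0 j0); rewrite ?andbF/=; last by lia.
    case: (~~ _); rewrite ?andbF/=; last by lia.
    by rewrite !andbT; lia.
  rewrite E2 E1; congr (cap _ _ (_ + _)); rewrite /right_moves.
  suff -> : [&& on, [&& i == j0, i0 <= l, h l i == h i0 j0 &
     ~~ [&& 2 <= i0, 2 <= j0 & h i0 j0 == h i0.-1 j0.-1]] &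
     h l.+1 i == h l i] = false by rewrite orbF.
  apply/negP => /and3P[_ /and4P[/eqP e1 e2 _ _] _].
  by move: h0 hl i2 e2; rewrite e1 /is_label /=; lia.
case: on {IH bE eE} => /=; last first.
  rewrite /cap !addn0; case: leqP => // /hd[_ ?]; exact/minn_idPl.
rewrite /right_moves.
have [ij|ij] := eqVneq i j0; last first.
  rewrite andbF /= !addn0.
  rewrite /cap; case: leqP => // /hd[_ ?]; exact/minn_idPl.
subst i; rewrite andbT /=.
have [e1|e1] := eqVneq l.+1 i0.
  rewrite -e1 ltnn /= leqnn eqxx /= /cap.
  case: (leqP j0 1) => j1; first by rewrite ?andbF /=; lia.
  have [lb ?] := hd j1.
  have -> : 1 < l.+1 by move: lb; rewrite /is_label; lia.
  rewrite /=; lia.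
have -> : (i0 <= l.+1) = (i0 <= l) by lia.
case: (leqP i0 l) => i0l /=; last first.
  rewrite !addn0 /cap; case: leqP => // /hd[_ ?]; exact/minn_idPl.
set nb := ~~ _.
have hup : h i0 j0 <= h l j0 /\ h l j0 <= h l.+1 j0.
  have hl' : is_label k l j0.
    by move: hl h0 i0l; rewrite /is_label; lia.
  split; last exact: (H _ _ hl).1.
  have [m El] : exists m, l = i0 + m by exists (l - i0); lia.
  by rewrite El; apply: column_le => //; rewrite -El.
have -> : (h l j0 == h i0 j0) && nb && (h l.+1 j0 == h l j0) =
   (h l.+1 j0 == h i0 j0) && nb.
  by case: nb; rewrite ?andbF//= !andbT; lia.
rewrite /cap; case: (leqP j0 1) => // j1; have [lb lb2] := hd j1.
apply/minn_idPl.
case E: (_ && nb); rewrite ?addn0// addn1.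
move: E => /andP[/eqP-> ]; rewrite /nb.
have -> : 1 < i0 by move: h0 j1; rewrite /is_label; lia.
rewrite /= => ne.
have h0' : is_label k i0.-1 j0.-1.
  by move: h0 j1; rewrite /is_label; case: (j0) => [|[|?]]//=; lia.
apply: (@leq_trans (h i0.-1 j0.-1)).
  by have := (H _ _ h0).2 h0'; move: ne; lia.
have [m El] : exists m, l = i0.-1 + m by exists (l - i0.-1); lia.
by rewrite El; apply: column_le => //; rewrite -El.
Qed.

(** Away from the wall, a left noise of the wall particle lowers only its entry,
    as rows below are bounded from below by their upper neighbours. *)
Lemma full_row_down h a b i0 l i :
  interlaced h -> is_label k l i -> odd i0 -> 0 < h i0 i0.+1./2 ->
  (forall l i, is_label k l i -> b l i = 0) ->
  (forall l i, is_label k l i -> a l i = ((l == i0) && (i == i0.+1./2))) ->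
  full_row h a b l i = h l i - ((l == i0) && (i == i0.+1./2)).
Proof.
move=> H + oi0 h0 bE aE; elim: l i => [|l IH] i hl.
  by move: hl; rewrite /is_label.
have -> : full_row h a b l.+1 i =
  if i <= (l.+1)./2
  then cap (h l) i (maxn (full_row h a b l i) (h l.+1 i) + b l.+1 i)
  else cap (h l) i `|(h l.+1 i + b l.+1 i)%:Z - (a l.+1 i)%:Z| by [].
have hc v : v <= h l.+1 i -> cap (h l) i v = v.
  move=> vh; rewrite /cap; case: leqP => // i1.
  have h' : is_label k l i.-1.
    by move: hl i1; rewrite /is_label; case: i {vh} => [|[|i]]//=; lia.
  by apply/minn_idPl; apply: leq_trans vh _; exact: (H _ _ hl).2.
rewrite bE// aE// !addn0.
case: leqP => i2.
  have hl' : is_label k l i by move: hl i2; rewrite /is_label /=; lia.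
  have hup := (H _ _ hl).1 hl'.
  have -> : (l.+1 == i0) && (i == (i0.+1)./2) = false.
    by apply/negbTE/negP => /andP[/eqP e1 /eqP e2]; lia.
  rewrite subn0 IH// (_ : maxn _ _ = h l.+1 i); first exact: hc.
  by apply/maxn_idPr; apply: leq_trans hup; exact: leq_subr.
case E: ((l.+1 == i0) && _); last by rewrite subr0 subn0 /=; apply: hc.
move: E => /andP[/eqP e1 /eqP e2]; rewrite -e2 -e1 in h0.
rewrite (_ : `|_| = h l.+1 i - 1)%N; last by lia.
by apply: hc; lia.
Qed.

(** The only bound at risk is the one by the upper-left neighbour; it is strict
    at (i0, j0) unless the jump is blocked, and then strict along the column. *)
Lemma right_moves_interlaced h i0 j0 : interlaced h -> is_label k i0 j0 ->
  interlaced (fun l i => h l i + right_moves h i0 j0 l i).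
Proof.
move=> H h0 l i hl; have [H1 H2] := H _ _ hl; split=> h'.
  have := H1 h'; rewrite /right_moves.
  case: (_ == j0) => //=; rewrite ?addn0//.
  case: (~~ _); rewrite ?andbF ?addn0// !andbT; lia.
have := H2 h'; case R: (right_moves h i0 j0 l i) => /=; last by lia.
move: R => /and4P[/eqP e il /eqP ev nb] _; subst i.
suff : h l j0 < h l.-1 j0.-1 by lia.
have j1 : 1 < j0 by move: h'; rewrite /is_label; lia.
have i1 : 1 < i0 by move: h0 j1; rewrite /is_label; lia.
rewrite ev; move: nb; rewrite i1 j1 /= => nb.
have h0' : is_label k i0.-1 j0.-1 by move: h0 j1; rewrite /is_label; lia.
apply: (@leq_trans (h i0.-1 j0.-1)).
  by have := (H _ _ h0).2 h0'; move: nb; lia.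
have [m El] : exists m, l.-1 = i0.-1 + m by exists (l.-1 - i0.-1); lia.
by rewrite El; apply: column_le => //; rewrite -El.
Qed.

Lemma left_moves_interlaced x i0 j0 : interlaced x -> is_label k i0 j0 ->
  j0 <= i0./2 -> interlaced (fun l i => x l i - left_moves x i0 j0 l i).
Proof.
move=> H h0 j0i l i hl; have [H1 H2] := H _ _ hl; split=> h'; last first.
  have := H2 h'; rewrite /left_moves.
  case: (ltnP l i0) => il; first by lia.
  have [e|e] := eqVneq (i + i0) (l + j0); last first.
    by move: hl h'; rewrite /is_label /=; lia.
  have [e'|e'] := eqVneq l i0; first by move: h0; rewrite /is_label; lia.
  have -> : i.-1 + i0 = l.-1 + j0.
    by move: hl h'; rewrite /is_label; lia.
  have -> : i0 <= l.-1 by lia.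
  rewrite /= eqxx /=.
  case: (x i0 j0 != x i0.-1 j0); rewrite ?andbF; last by lia.
  have : x l.-1 i.-1 <= x i0 j0.
    have [m El] : exists m, l.-1 = i0 + m by exists (l.-1 - i0); lia.
    have Ei : i.-1 = j0 + m by move: hl h'; rewrite /is_label; lia.
    by rewrite El Ei; apply: diagonal_ge => //; rewrite -El -Ei.
  lia.
have := H1 h'; case R: (left_moves x i0 j0 l i) => /=; last by lia.
move: R => /and4P[il /eqP e /eqP ev nb] _.
suff : x l.-1 i < x l i by lia.
rewrite ev.
have h0' : is_label k i0.-1 j0 by move: h0 j0i; rewrite /is_label; lia.
have [m El] : exists m, l.-1 = i0.-1 + m by exists (l.-1 - i0.-1); lia.
have Ei : i = j0 + m by move: h0 hl; rewrite /is_label; lia.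
have : x l.-1 i <= x i0.-1 j0.
  by rewrite El Ei; apply: diagonal_ge => //; rewrite -El -Ei.
by have := (H _ _ h0).1 h0'; move: nb; lia.
Qed.

End Rows.

Section Configurations.
Context (k : nat).
Local Open Scope nat_scope.
Implicit Types x y : config k.

Lemma label_inj (p q : label k) : row p = row q -> col p = col q -> p = q.
Proof.
case: p q => [[a b] ha] [[c d] hc]; rewrite /row /col /= => /val_inj e1 /val_inj e2.
by move: ha hc; rewrite e1 e2 => ha hc; congr exist; exact: bool_irrelevance.
Qed.

Lemma label_rc (p : label k) : is_label k (row p) (col p).
Proof. exact: (valP p). Qed.

Lemma label_ex i j : is_label k i j ->
  exists2 p : label k, row p = i & col p = j.
Proof.
move=> h.
have hi : i < k.+1 by move: h; rewrite /is_label; lia.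
have hj : j < k.+1 by move: h; rewrite /is_label; lia.
by exists (Sub (Ordinal hi, Ordinal hj) h).
Qed.

Lemma entry_rc (f : label k -> nat) p : entry f (row p) (col p) = f p.
Proof.
rewrite /entry; case: pickP => [q /andP[/eqP e1 /eqP e2]|/(_ p)].
  by rewrite (label_inj e1 e2).
by rewrite !eqxx.
Qed.

Lemma entryE (f : label k -> nat) (F : nat -> nat -> nat) :
  (forall p, f p = F (row p) (col p)) ->
  forall i j, is_label k i j -> entry f i j = F i j.
Proof. by move=> fF i j /label_ex[p <- <-]; rewrite entry_rc. Qed.

Definition ordered x : Prop := interlaced k (entry x).

Lemma ordered0 : ordered (config0 k).
Proof.
have E i j : entry (config0 k) i j = 0.
  by rewrite /entry; case: pickP => // p _; rewrite ffunE.
by move=> i j _; rewrite !E.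
Qed.

(** Monotonicity along the column turns the maximum that defines the reach into
    a test on a single entry. *)
Lemma right_reachP y i j m : ordered y -> is_label k i j ->
  is_label k (i + m) j ->
  (m <= right_reach y i j) = (entry y (i + m) j == entry y i j).
Proof.
move=> oy h0 hm; have mk : m < k.+1 by move: h0 hm; rewrite /is_label; lia.
apply/idP/eqP => [|e]; last first.
  apply: (@leq_bigmax_cond _ _ (fun l : 'I_k.+1 => l : nat) (Ordinal mk)).
  by rewrite /= hm e eqxx.
rewrite /right_reach.
have [|l /andP[hl /eqP e] ->] := @eq_bigmax_cond 'I_k.+1 [pred l : 'I_k.+1 |
    is_label k (i + l) j && (entry y (i + l) j == entry y i j)]
    (fun l : 'I_k.+1 => l : nat).
  by apply/card_gt0P; exists ord0; rewrite inE addn0 h0 eqxx.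
move=> ml; apply/eqP; rewrite eqn_leq (column_le oy h0 hm) -e.
rewrite andbT -(subnKC ml) addnA in hl *.
by apply: (column_le oy).
Qed.

Lemma left_reachP y i j m : ordered y -> is_label k i j ->
  is_label k (i + m) (j + m) ->
  (m <= left_reach y i j) = (entry y (i + m) (j + m) == entry y i j).
Proof.
move=> oy h0 hm; have mk : m < k.+1 by move: h0 hm; rewrite /is_label; lia.
apply/idP/eqP => [|e]; last first.
  apply: (@leq_bigmax_cond _ _ (fun l : 'I_k.+1 => l : nat) (Ordinal mk)).
  by rewrite /= hm e eqxx.
rewrite /left_reach.
have [|l /andP[hl /eqP e] ->] := @eq_bigmax_cond 'I_k.+1 [pred l : 'I_k.+1 |
    is_label k (i + l) (j + l) && (entry y (i + l) (j + l) == entry y i j)]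
    (fun l : 'I_k.+1 => l : nat).
  by apply/card_gt0P; exists ord0; rewrite inE !addn0 h0 eqxx.
move=> ml; apply/eqP; rewrite eqn_leq (diagonal_ge oy h0 hm) -e /=.
rewrite -(subnKC ml) !addnA in hl *.
by apply: (diagonal_ge oy).
Qed.

Lemma jump_rightE p y q : ordered y ->
  jump_right p y q = y q + right_moves (entry y) (row p) (col p) (row q) (col q).
Proof.
move=> oy; rewrite /jump_right /right_moves -/(row _).
case: ifPn => [_|nb]; first by rewrite !andbF addn0.
rewrite andbT ffunE (entry_rc y p) (entry_rc y q).
have [e|e] := eqVneq (col q) (col p); last by rewrite andbF addn0.
case: (leqP (row p) (row q)) => pq; last by rewrite addn0.
have hq := label_rc q; rewrite e -(subnKC pq) in hq.
have := right_reachP oy (label_rc p) hq.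
have Eq : entry y (row q) (col p) = y q by rewrite -e entry_rc.
rewrite subnKC// Eq (entry_rc y p) => <-.
rewrite leq_subLR andbT /=.
by case: ifP => _; rewrite ?addn1 ?addn0.
Qed.

Lemma jump_left_chainE p y q : ordered y ->
  ~~ (odd (row p) && (col p == (row p).+1./2)) ->
  jump_left p y q = y q - left_moves (entry y) (row p) (col p) (row q) (col q).
Proof.
move=> oy /negbTE np; rewrite /jump_left np /left_moves.
case: ifPn => [_|nb]; first by rewrite !andbF subn0.
rewrite andbT ffunE (entry_rc y p) (entry_rc y q).
case: (leqP (row p) (row q)) => pq; last by rewrite subn0.
have [e|e] := eqVneq (col q + row p) (row q + col p); last first.
  by rewrite andbF subn0.
have hq := label_rc q; have ec : col q = col p + (row q - row p) by lia.
rewrite {1}ec -[X in is_label k X](subnKC pq) in hq.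
have := left_reachP oy (label_rc p) hq.
rewrite subnKC// -ec !entry_rc => <-.
rewrite leq_subLR andbT /=.
by case: ifP => _; rewrite ?subn1 ?subn0.
Qed.

Lemma X_step_id x (xi : noise k) n : ordered x ->
  (forall p b, xi (p, n, b) = 0) ->
  X_full_step xi n (X_half_step xi n x) = x.
Proof.
move=> ox xi0.
have z b l i : is_label k l i -> entry (fun q => xi (q, n, b)) l i = 0.
  by move=> h; rewrite (entryE (F := fun _ _ => 0) _ h).
have -> : X_half_step xi n x = x.
  apply/ffunP => p; rewrite ffunE (@half_row_id k) ?entry_rc//; first exact: label_rc.
  by move=> l i h _; exact: z.
apply/ffunP => p; rewrite ffunE.
rewrite (@full_row_right k _ _ _ (fun _ _ => 0) false (row p) (col p))
  ?entry_rc ?addn0//; try exact: label_rc.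
move=> l i h; rewrite !z//; case: ifP => // _; lia.
Qed.

Lemma jump_left_topE p y q : odd (row p) -> col p = (row p).+1./2 ->
  jump_left p y q = if y p == 0 then jump_right p y q else y q - (q == p).
Proof.
move=> op cp; rewrite /jump_left op {1}cp eqxx (entry_rc y p).
case: eqP => // _; rewrite ffunE; case: eqP => _; lia.
Qed.

Lemma down_ordered y p : ordered y -> odd (row p) -> col p = (row p).+1./2 ->
  ordered [ffun q => y q - (q == p)].
Proof.
move=> oy op cp i j h; split => h'.
  have := (oy _ _ h).1 h'; move: h h'.
  move=> /label_ex[q <- <-] /label_ex[r e1 e2].
  have E (f : label k -> nat) : entry f (row q).-1 (col q) = f r.
    by rewrite -e1 -e2 entry_rc.
  rewrite !E !entry_rc !ffunE; case: (q =P p) => [qp|]; last by lia.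
  by move: (label_rc r); rewrite e1 e2 qp /is_label; lia.
have := (oy _ _ h).2 h'; move: h h'.
move=> /label_ex[q <- <-] /label_ex[r e1 e2]; rewrite -e1 -e2.
rewrite !entry_rc !ffunE; case: (r =P p) => [rp|]; last by lia.
by move: (label_rc q) (label_rc r) e1 e2; rewrite rp /is_label; lia.
Qed.

Lemma orderedE y F : interlaced k F -> (forall p, y p = F (row p) (col p)) ->
  ordered y.
Proof.
move=> HF yF i j h; have [H1 H2] := HF _ _ h.
by split=> h'; rewrite !(entryE yF)//; [exact: H1|exact: H2].
Qed.

Lemma jump_ordered c y : ordered y -> ordered (jump c y).
Proof.
move=> oy; have hp := label_rc c.1.
have oR : ordered (jump_right c.1 y).
  apply: orderedE (right_moves_interlaced oy hp) _ => q.
  by rewrite jump_rightE// entry_rc.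
rewrite /jump; case: ifP => // _.
have [/andP[op /eqP cp]|ntop] :=
    boolP (odd (row c.1) && (col c.1 == (row c.1).+1./2)).
  have [y0|y0] := eqVneq (y c.1) 0.
    rewrite (_ : jump_left _ _ = jump_right c.1 y)//; apply/ffunP => q.
    by rewrite jump_left_topE// y0.
  rewrite (_ : jump_left _ _ = [ffun q => y q - (q == c.1)]).
    exact: down_ordered.
  by apply/ffunP => q; rewrite jump_left_topE// (negbTE y0) ffunE.
have j0 : col c.1 <= (row c.1)./2 by move: hp ntop; rewrite /is_label; lia.
apply: orderedE (left_moves_interlaced oy hp j0) _ => q.
by rewrite jump_left_chainE// entry_rc.
Qed.

(** With a single ring in the step, the two halves of the update do not
    interfere: one of them is the identity and the other performs the jump. *)
Lemma X_step_jump x (xi : noise k) n c : ordered x ->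
  (forall p b, xi (p, n, b) = ((p, b) == c)) ->
  X_full_step xi n (X_half_step xi n x) = jump c x.
Proof.
move=> ox xiE; have ojx := jump_ordered c ox.
case: c xiE ojx => p0 b0 xiE ojx.
have aE b l i : is_label k l i -> entry (fun q => xi (q, n, b)) l i =
    [&& b == b0, l == row p0 & i == col p0].
  move=> h; rewrite (entryE (F := fun l i =>
    [&& b == b0, l == row p0 & i == col p0]) _ h)// => p.
  by rewrite xiE xpair_eqE andbC; congr (nat_of_bool (_ && _)).
have hp0 := label_rc p0.
(* Every left noise acts in the first half, except that of a wall particle. *)
have half_id : (b0 || (odd (row p0) && (col p0 == (row p0).+1./2))) ->
    X_half_step xi n x = x.
  move=> hb; apply/ffunP => p; rewrite ffunE (@half_row_id k) ?entry_rc//.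
    exact: label_rc.
  by move=> l i h il; rewrite aE//; move: hb; case: (b0) => //=; lia.
have full_up : X_half_step xi n x = x ->
    (forall l i, is_label k l i ->
     if i <= l./2
     then entry (fun q => xi (q, n, true)) l i = ((l == row p0) && (i == col p0))
     else `|(entry x l i + entry (fun q => xi (q, n, true)) l i)%:Z -
            (entry (fun q => xi (q, n, false)) l i)%:Z| =
          entry x l i + ((l == row p0) && (i == col p0))) ->
    X_full_step xi n (X_half_step xi n x) = jump_right p0 x.
  move=> -> H; apply/ffunP => p; rewrite ffunE jump_rightE//.
  rewrite (@full_row_right k _ _ _ (fun l i => (l == row p0) && (i == col p0))
    true (row p0) (col p0)) ?entry_rc//; exact: label_rc.
rewrite /jump in ojx *; case: b0 => /= in xiE ojx aE half_id *.
  apply: full_up; first exact: half_id.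
  move=> l i h; rewrite !aE//=; case: ifP => // _; lia.
have [top|ntop] := boolP (odd (row p0) && (col p0 == (row p0).+1./2)); last first.
  have E : X_half_step xi n x = jump_left p0 x.
    apply/ffunP => p; rewrite ffunE jump_left_chainE//.
    rewrite (@half_row_left k _ _ (row p0) (col p0)) ?entry_rc//.
    - exact: label_rc.
    - by move: hp0 ntop; rewrite /is_label; lia.
    - by move=> l i h; rewrite aE.
  apply/ffunP => p; rewrite E ffunE.
  rewrite (@full_row_right k _ _ _ (fun _ _ => 0) false (row p0) (col p0))
    ?entry_rc ?addn0//; first exact: label_rc.
  move=> l i h; rewrite !aE//=; case: ifP => // il.
  suff -> : (l == row p0) && (i == col p0) = false by lia.
  apply/negP => /andP[/eqP e1 /eqP e2]; move: ntop il hp0; rewrite e1 e2.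
  by rewrite /is_label; lia.
have [op /eqP cp] := andP top.
have [x0|x0] := eqVneq (x p0) 0.
  have -> : jump_left p0 x = jump_right p0 x.
    by apply/ffunP => q; rewrite jump_left_topE// x0.
  apply: full_up; first exact: half_id.
  move=> l i h; rewrite !aE//=; case: ifP => il.
    suff -> : (l == row p0) && (i == col p0) = false by [].
    by apply/negP => /andP[/eqP e1 /eqP e2]; move: il op cp; rewrite e1 e2; lia.
  case E: (_ && _); last by lia.
  by move: E => /andP[/eqP-> /eqP->]; rewrite entry_rc x0.
rewrite half_id//; apply/ffunP => p; rewrite ffunE jump_left_topE// (negbTE x0).
rewrite (@full_row_down k _ _ _ (row p0)) ?entry_rc//.
- congr (_ - nat_of_bool _); rewrite -cp.
  by apply/andP/eqP => [[/eqP e1 /eqP e2]|->]; [exact: label_inj|rewrite !eqxx].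
- exact: label_rc.
- by rewrite -cp entry_rc lt0n.
- by move=> l i h; rewrite aE.
- by move=> l i h; rewrite aE// -cp.
Qed.

End Configurations.

(** * Rings of a clock on the integer grid *)
Section Renewal.
Local Open Scope nat_scope.
Implicit Types (d x : nat -> nat) (L m n : nat).

(** The step of ring [m] of a clock whose successive gaps are [d].  A gap may be
    0, and then several rings fall into one step. *)
Definition ring_step d m : nat := \sum_(j < m.+1) d j.

(** The least [m] with [n <= ring_step d m]; the value 0 is a default for clocks
    whose rings all occur before step [n]. *)
Definition rings_before d n : nat :=
  if pselect (exists m, n <= ring_step d m) is left e then ex_minn e else 0.

Definition rings_at d n : nat := rings_before d n.+1 - rings_before d n.

Definition endless d : Prop := forall n, exists m, n <= ring_step d m.

Lemma ring_stepS d m : ring_step d m.+1 = ring_step d m + d m.+1.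
Proof. by rewrite /ring_step big_ord_recr. Qed.

Lemma ring_step_le d m m' : m <= m' -> ring_step d m <= ring_step d m'.
Proof.
move=> /subnKC <-; elim: (m' - m) => [|i IH]; first by rewrite addn0.
by rewrite addnS ring_stepS; apply: leq_trans IH (leq_addr _ _).
Qed.

Lemma rings_beforeP d n m : endless d ->
  (rings_before d n <= m) = (n <= ring_step d m).
Proof.
move=> dE; rewrite /rings_before; case: pselect => [e|/(_ (dE n))//].
case: ex_minnP => i ni imin; apply/idP/idP => [im|/imin//].
exact: leq_trans ni (ring_step_le _ im).
Qed.

Lemma rings_before_le d n : endless d -> rings_before d n <= rings_before d n.+1.
Proof.
move=> dE; rewrite rings_beforeP//.
by apply: leq_trans (leqnSn _) _; rewrite -rings_beforeP.
Qed.

Lemma rings_at_none d n : endless d -> (forall m, ring_step d m != n) ->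
  rings_at d n = 0.
Proof.
move=> dE dn; apply/eqP; rewrite subn_eq0 rings_beforeP//.
by rewrite ltn_neqAle eq_sym dn -rings_beforeP /=.
Qed.

Lemma rings_at_one d n m0 : endless d ->
  (forall m, (ring_step d m == n) = (m == m0)) -> rings_at d n = 1.
Proof.
move=> dE dn; have /eqP vm : ring_step d m0 == n by rewrite dn.
have H1 : rings_before d n = m0.
  apply/eqP; rewrite eqn_leq rings_beforeP// vm leqnn /= leqNgt.
  apply/negP => lt; have := dn (rings_before d n).
  rewrite (ltn_eqF lt) => /negP; apply; rewrite eqn_leq -{2}vm.
  by rewrite ring_step_le ?(ltnW lt)//= -rings_beforeP.
have H2 : rings_before d n.+1 = m0.+1.
  apply/eqP; rewrite eqn_leq; apply/andP; split; last first.
    by rewrite ltnNge rings_beforeP// vm ltnn.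
  rewrite rings_beforeP// ltn_neqAle eq_sym dn (gtn_eqF (ltnSn _)) /=.
  by rewrite -vm ring_step_le.
by rewrite /rings_at H1 H2 subSnn.
Qed.

(** A pair (s, r) stands for the event that the first gaps are [s] and that the
    next one is at least [r]; [gap_code x L] is the event that the first [L]
    counts are given by [x].  A further count 0 prolongs the open gap.  A count
    [c.+1] closes it at its current length, adds [c] gaps 0, and opens a gap of
    length at least 1. *)
Fixpoint gap_code x L : seq nat * nat :=
  if L is L'.+1 then
    let g := gap_code x L' in
    if x L' is c.+1 then (g.1 ++ g.2 :: nseq c 0, 1) else (g.1, g.2.+1)
  else ([::], 0).

Lemma gap_code_size x L : size (gap_code x L).1 = \sum_(n < L) x n.
Proof.
elim: L => [|L IH] /=; first by rewrite big_ord0.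
rewrite big_ord_recr /= -IH; case: (x L) => [|c] /=; first by rewrite addn0.
by rewrite size_cat /= size_nseq.
Qed.

(** The number of whole steps consumed, hence the exponent of [1 - q] in the
    probability of the box. *)
Lemma gap_code_sum x L : sumn (gap_code x L).1 + (gap_code x L).2 = L.
Proof.
elim: L => [|L IH] //=; case: (x L) => [|c] /=; first by rewrite addnS IH.
by rewrite sumn_cat /= sumn_nseq mul0n addn0 IH addn1.
Qed.

Lemma gap_code_nil x L : (gap_code x L).2 = 0 -> (gap_code x L).1 = [::].
Proof. by case: L => //= L; case: (x L). Qed.

Definition in_gap_box d (g : seq nat * nat) : Prop :=
  (forall m, m < size g.1 -> d m = nth 0 g.1 m) /\ g.2 <= d (size g.1).

Lemma sumn_gaps d s : (forall m, m < size s -> d m = nth 0 s m) ->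
  \sum_(j < size s) d j = sumn s.
Proof.
move=> H; rewrite sumnE (big_nth 0) big_mkord.
by apply: eq_bigr => i _; exact: H.
Qed.

Lemma in_gap_box_count d x L : endless d -> in_gap_box d (gap_code x L) ->
  rings_before d L = size (gap_code x L).1.
Proof.
move=> dE [H1 H2]; have S0 := sumn_gaps H1; have SL := gap_code_sum x L.
move: H1 H2 S0 SL (@gap_code_nil x L); case: (gap_code x L) => s r /= H1 H2 S0 SL r0.
apply/eqP; rewrite eqn_leq rings_beforeP//; apply/andP; split.
  by rewrite /ring_step big_ord_recr /= S0; lia.
have [->//|s0] := posnP (size s).
rewrite -(prednK s0) ltnNge rings_beforeP// -ltnNge /ring_step prednK// S0.
suff : 0 < r by lia.
by rewrite lt0n; apply/eqP => /r0 s1; rewrite s1 in s0.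
Qed.

(** Given the box of the first [L] counts, the rings before step [L] are those of
    the closed gaps, and the count at step [L] says how the open gap continues. *)
Lemma rings_at_box d x L : endless d ->
  (forall n, n < L -> rings_at d n = x n) <-> in_gap_box d (gap_code x L).
Proof.
move=> dE; elim: L => [|L IH]; first by split.
have -> : (forall n, n < L.+1 -> rings_at d n = x n) <->
    in_gap_box d (gap_code x L) /\ rings_at d L = x L.
  rewrite -IH; split=> [H|[H1 H2] n].
    by split=> [n nL|]; apply: H => //; exact: leqW.
  by rewrite ltnS leq_eqVlt => /predU1P[->//|]; exact: H1.
have Hc := @in_gap_box_count d x L dE.
rewrite /= /rings_at; have LE := rings_before_le L dE.
have SL := gap_code_sum x L.
move: Hc SL; case: (gap_code x L) => s r /= Hc SL.
case xL: (x L) => [|c] /=.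
  split=> [[b]|[H1 H2]].
    have [H1 H2] := b; move/eqP; rewrite subn_eq0 rings_beforeP// Hc//.
    rewrite /ring_step big_ord_recr /= sumn_gaps// => h.
    by split => //=; lia.
  have b : in_gap_box d (s, r) by split=> //; exact: ltnW.
  split=> //; apply/eqP; rewrite subn_eq0 rings_beforeP// Hc//.
  by rewrite /ring_step big_ord_recr /= sumn_gaps//; move: H2 => /=; lia.
have nthE m : nth 0 (s ++ r :: nseq c 0) m =
    if m < size s then nth 0 s m else if m == size s then r else 0.
  rewrite nth_cat; case: ltnP => // sm; have [->|ne] := eqVneq; first by rewrite subnn.
  have -> : m - size s = (m - size s).-1.+1 by lia.
  by rewrite /= nth_nseq; case: ifP.
have sizeE : size (s ++ r :: nseq c 0) = size s + c.+1.
  by rewrite size_cat /= size_nseq.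
have split_sum i : \sum_(j < size s + i.+1) d j =
    \sum_(j < size s) d j + d (size s) + \sum_(j < i) d (size s + j.+1).
  rewrite big_split_ord /= big_ord_recl /= addn0 addnA; congr (_ + _ + _).
(* The rings of index [size s] to [size s + c] all fall into step [L]: the first
   of them closes the open gap at length [r], and the next gaps vanish. *)
split=> [[b H]|[H1 H2]].
  have [H1 H2] := b; move: H2 H LE => /= H2 H LE; rewrite (Hc b) in H LE.
  have HB : rings_before d L.+1 = size s + c.+1 by lia.
  have h1 : L < ring_step d (size s + c.+1) by rewrite -rings_beforeP// HB.
  have h2 : ring_step d (size s + c) <= L.
    by rewrite leqNgt -rings_beforeP// HB; lia.
  move: h1 h2; rewrite /ring_step -!addnS !split_sum sumn_gaps// => h1 h2.
  have Z : \sum_(j < c) d (size s + j.+1) = 0 by lia.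
  split=> [m|] /=; last first.
    by rewrite sizeE; move: h1; rewrite big_ord_recr /= Z; lia.
  rewrite sizeE nthE => mc; case: (ltnP m (size s)) => sm; first exact: H1.
  have [->|ne] := eqVneq m (size s); first by lia.
  have jc : m - (size s).+1 < c by lia.
  move/eqP: Z; rewrite sum_nat_eq0 => /forallP/(_ (Ordinal jc)) /eqP /= <-.
  by congr d; lia.
have b : in_gap_box d (s, r).
  split=> /= [m sm|].
    by rewrite H1 /= ?nthE ?sm// sizeE; lia.
  by rewrite H1 /= ?nthE ?ltnn ?eqxx// sizeE; lia.
split=> //; rewrite (Hc b).
have ds : d (size s) = r by rewrite H1 /= ?nthE ?ltnn ?eqxx// sizeE; lia.
have Z : \sum_(j < c) d (size s + j.+1) = 0.
  apply/eqP; rewrite sum_nat_eq0; apply/forallP => j; apply/eqP.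
  rewrite H1 /= ?nthE ?sizeE; last by case: j => /= j; lia.
  by rewrite ltnNge leq_addr /=; case: eqP => //; lia.
suff -> : rings_before d L.+1 = size s + c.+1 by lia.
apply/eqP; rewrite eqn_leq rings_beforeP//; apply/andP; split.
  rewrite /ring_step -addnS split_sum big_ord_recr /= Z ds (sumn_gaps b.1) /=.
  by move: H2; rewrite /= sizeE; lia.
rewrite addnS ltnNge rings_beforeP// -leqNgt /ring_step -addnS split_sum Z ds.
by rewrite (sumn_gaps b.1) /=; lia.
Qed.

End Renewal.

(** * Expectations *)
Section IntegralLemmas.
Import HBNNSimple.
Context d (T : measurableType d) (R : realType) (mu : {measure set T -> \bar R}).
Local Open Scope ereal_scope.

Let simple_integrals (f : T -> \bar R) : set (\bar R) :=
  [set sintegral mu h | h in [set h : {nnsfun T >-> R} | forall x, (h x)%:E <= f x]].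

Let simple_integrals_ae (f g : T -> \bar R) : (forall x, 0 <= g x) ->
  {ae mu, forall x, f x = g x} -> simple_integrals f `<=` simple_integrals g.
Proof.
move=> g0 [N [mN N0 fgN]] _ [h hf <-].
pose h' := proj_nnsfun h (measurableC mN).
exists h' => [x|].
  rewrite /h' -mrestrict patchE.
  case: ifPn => [/set_mem Nx|_]; last exact: g0.
  rewrite -[leRHS](_ : f x = _); first exact: hf.
  by apply: contrapT => fg; apply: Nx; exact: fgN.
rewrite -!integralT_nnsfun; apply: ae_eq_integral => //.
- exact/measurable_EFinP.
- exact/measurable_EFinP.
exists N; split=> // x hx; apply: contrapT => Nx; apply: hx => _.
by rewrite /h' -mrestrict patchE mem_set.
Qed.

(** The integral is a difference of suprema over simple functions below the
    function, and the integral of a simple function does not see null sets.  This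
    serves for a functional of the limit path, which is only almost surely equal
    to a measurable function. *)
Lemma ae_eq_integral_any (f g : T -> \bar R) :
  {ae mu, forall x, f x = g x} -> \int[mu]_x f x = \int[mu]_x g x.
Proof.
move=> fg; rewrite /integral !patch_setT.
have E (u v : T -> \bar R) : (forall x, 0 <= u x) -> (forall x, 0 <= v x) ->
    {ae mu, forall x, u x = v x} ->
    ereal_sup (simple_integrals u) = ereal_sup (simple_integrals v).
  move=> u0 v0 uv; congr ereal_sup; apply/seteqP; split.
    exact: simple_integrals_ae.
  by apply: simple_integrals_ae => //; apply: filterS uv => x ->.
congr (_ - _); apply: E.
- by move=> x; exact: funepos_ge0.
- by move=> x; exact: funepos_ge0.
- by apply: filterS fg => x fgx; rewrite !funeposE fgx.
- by move=> x; exact: funeneg_ge0.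
- by move=> x; exact: funeneg_ge0.
- by apply: filterS fg => x fgx; rewrite !funenegE fgx.
Qed.

End IntegralLemmas.

Section Expectations.
Context (R : realType).
Local Open Scope ereal_scope.

(** Bounded convergence applies with the upper limit of the [f_ n], which is
    measurable and almost surely equal to [f]. *)
Lemma cvg_expectation_ae d (T : measurableType d) (P : probability T R)
    (f_ : nat -> T -> R) (f : T -> R) (M : R) :
  (forall n, measurable_fun setT (f_ n)) ->
  (forall n w, (`|f_ n w| <= M)%R) ->
  {ae P, forall w, f_ n w @[n --> \oo] --> f w} ->
  'E_P[f_ n] @[n --> \oo] --> 'E_P[f].
Proof.
move=> mf fM fcvg; rewrite unlock.
pose g w := limn_esup (fun n => (f_ n w)%:E).
have mEf n : measurable_fun setT (fun w => (f_ n w)%:E) by exact/measurable_EFinP.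
have EFcvg w : f_ n w @[n --> \oo] --> f w -> (f_ n w)%:E @[n --> \oo] --> (f w)%:E.
  by move=> h; apply: cvg_EFin => //; exact: nearW.
have fg : {ae P, forall w, (f w)%:E = g w}.
  apply: filterS fcvg => w /EFcvg h.
  by rewrite /g; have [_ ->] := cvg_limn_einf_sup h.
rewrite (ae_eq_integral_any fg).
have [] := @dominated_convergence _ _ _ P setT measurableT
  (fun n w => (f_ n w)%:E) g (cst M%:E) => //.
- exact: measurable_fun_limn_esup.
- by apply: filterS2 fcvg fg => w h <- _; exact: EFcvg.
- by apply: finite_measure_integrable_cst.
- by apply: aeW => w n _ /=; rewrite lee_fin.
Qed.

(** Both sides are integrals of [g] against the image laws, which are determined
    by their atoms. *)
Lemma expectation_discrete d1 (T1 : measurableType d1) (P1 : probability T1 R)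
    d2 (T2 : measurableType d2) (P2 : probability T2 R)
    (V1 : T1 -> nat) (V2 : T2 -> nat) (g : nat -> R) (M : R) :
  (forall n, measurable (V1 @^-1` [set n])) ->
  (forall n, measurable (V2 @^-1` [set n])) ->
  (forall n, P1 (V1 @^-1` [set n]) = P2 (V2 @^-1` [set n])) ->
  (forall n, (`|g n| <= M)%R) ->
  'E_P1[g \o V1] = 'E_P2[g \o V2].
Proof.
move=> m1 m2 PE gM; rewrite unlock.
have mV d (T : measurableType d) (V : T -> nat) :
    (forall n, measurable (V @^-1` [set n])) -> measurable_fun setT V.
  move=> mV _ B _; rewrite setTI.
  rewrite (_ : V @^-1` B = \bigcup_(n in B) V @^-1` [set n]).
    by apply: bigcup_measurable.
  by apply/seteqP; split=> [x Bx|x [n Bn /= Vn]]; [exists (V x)|rewrite /= Vn].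
have pushE d (T : measurableType d) (P : probability T R) (V : T -> nat) :
    (forall n, measurable (V @^-1` [set n])) ->
    \int[P]_w ((g \o V) w)%:E = \int[pushforward P V]_n (g n)%:E.
  move=> hV; have mv := mV _ _ _ hV.
  have mg : measurable_fun [set: nat] (fun n => (g n)%:E) by [].
  rewrite (integral_pushforward mv mg) ?preimage_setT//.
  apply: (@le_integrable _ _ _ _ setT _ _ (cst M%:E)) => //.
  - exact: measurableT_comp mg mv.
  - by move=> w _; rewrite /= lee_fin (le_trans (gM _))// ler_norm.
  - by apply: finite_measure_integrable_cst.
rewrite !pushE//.
have mv1 := mV _ _ _ m1; have mv2 := mV _ _ _ m2.
apply: eq_measure_integral => A _ _.
have pA d (T : measurableType d) (P : probability T R) (V : T -> nat) :
    (forall n, measurable (V @^-1` [set n])) ->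
    pushforward P V A = \sum_(0 <= n <oo | n \in A) P (V @^-1` [set n]).
  move=> hV; rewrite /pushforward.
  rewrite (_ : V @^-1` A = \bigcup_(n in A) V @^-1` [set n]).
    rewrite measure_bigcup// => i j _ _ [x [<- <-]]//.
  by apply/seteqP; split=> [x Bx|x [n Bn /= Vn]]; [exists (V x)|rewrite /= Vn].
apply: etrans (esym (pA _ _ P2 _ m2)); apply: etrans (pA _ _ P1 _ m1) _.
by apply: eq_eseriesr => n _; exact: PE.
Qed.

End Expectations.

(** * Exponential laws and independence *)
Section ExponentialLaw.
Context (R : realType) (Q : probability R R).
Hypothesis QE : forall B : set R, measurable B -> Q B = exponential_prob 1 B.
Local Open Scope ereal_scope.

Lemma exp_set1 x : Q [set x] = 0.
Proof. by rewrite QE// /exponential_prob integral_set1. Qed.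

Lemma exp_lt0 : Q `]-oo, 0%R[%classic = 0.
Proof.
rewrite QE// /exponential_prob integral0_eq// => x /=.
by rewrite in_itv/= => x0; rewrite lt0_exponential_pdf.
Qed.

Lemma exp_le0 : Q `]-oo, 0%R]%classic = 0.
Proof.
have -> : `]-oo, 0%R]%classic = `]-oo, 0%R[%classic `|` [set 0%R] :> set R.
  apply/seteqP; split=> x /=; rewrite !in_itv/=.
    by rewrite le_eqVlt => /orP[/eqP|]; [right|left].
  by move=> [/ltW//|->].
apply/eqP; rewrite -measure_le0 -[leRHS](adde0) -{1}exp_lt0 -(exp_set1 0%R).
by apply: measureU2.
Qed.

Lemma exp_tail x : (0 <= x)%R -> Q `[x, +oo[%classic = (expR (- x))%:E.
Proof.
move=> x0.
have -> : `[x, +oo[%classic = ~` `]-oo, x[%classic :> set R.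
  by rewrite setCitvl.
rewrite probability_setC//.
suff -> : Q `]-oo, x[%classic = (1 - expR (- x))%:E.
  by rewrite -EFinB; congr EFin; rewrite subKr.
move: x0; rewrite le_eqVlt => /predU1P[<-|x0].
  by rewrite oppr0 expR0 subrr exp_lt0.
have -> : `]-oo, x[%classic = `]-oo, 0%R[%classic `|` `[0%R, x[%classic :> set R.
  apply/seteqP; split=> y /=; rewrite !in_itv/=.
    by move=> ->; rewrite andbT; case: (leP 0%R y) => _; [right|left].
  by move=> [y0|/andP[]//]; exact: lt_trans x0.
rewrite measureU//; last first.
  apply/seteqP; split=> // y [] /=; rewrite !in_itv/= => h1 /andP[h2 _].
  by move: h1; rewrite ltNge h2.
rewrite [X in X + _]exp_lt0 add0e.
have := @exponential_prob_itv0c R 1 x x0; rewrite -QE// mulN1r => h.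
rewrite EFinB -h.
have -> : `[0%R, x]%classic = `[0%R, x[%classic `|` [set x] :> set R.
  apply/seteqP; split=> y /=; rewrite !in_itv/=.
    by move=> /andP[->]; rewrite le_eqVlt => /orP[/eqP|]; [right|left].
  by move=> [/andP[y0 yx]|yx]; [rewrite y0 ltW|rewrite yx lexx ltW].
rewrite measureU//; first by rewrite [X in _ + X]exp_set1 adde0.
by apply/seteqP; split=> // y [] /= + yx; rewrite in_itv/= yx ltxx andbF.
Qed.

Lemma exp_slab x y : (0 <= x)%R -> (x <= y)%R ->
  Q `[x, y[%classic = (expR (- x) - expR (- y))%:E.
Proof.
move=> x0 xy; have y0 := le_trans x0 xy.
have := exp_tail x0.
have -> : `[x, +oo[%classic = `[x, y[%classic `|` `[y, +oo[%classic :> set R.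
  apply/seteqP; split=> z /=; rewrite !in_itv/= ?andbT.
    by move=> ->; case: (ltP z y); [left|right].
  by move=> [/andP[]//|]; exact: le_trans.
rewrite measureU//; last first.
  apply/seteqP; split=> // z [] /=; rewrite !in_itv/= andbT.
  by move=> /andP[_]; rewrite ltNge => /negbTE ->.
rewrite [X in _ + X](exp_tail y0) EFinB => <-.
by rewrite addeK.
Qed.

End ExponentialLaw.

Section Independence.
Context d (T : measurableType d) (R : realType) (P : probability T R).
Context d' (T' : measurableType d') (I : choiceType) (Z : I -> {RV P >-> T'}).
Local Open Scope ereal_scope.

Lemma mutually_independent_seq (s : seq I) (B : I -> set T') :
  mutually_independent Z -> uniq s -> (forall i, measurable (B i)) ->
  P [set w | forall i, i \in s -> B i (Z i w)] =
  \prod_(i <- s) P (Z i @^-1` B i).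
Proof.
move=> indep us mB; have := indep [fset x in s]%fset B mB.
have -> : \bigcap_(i in [set` [fset x in s]%fset]) (Z i @^-1` B i) =
    [set w | forall i, i \in s -> B i (Z i w)].
  by apply/seteqP; split=> w h i; have := h i; rewrite /= inE.
move=> ->; apply: perm_big; apply: uniq_perm => //.
by move=> i; rewrite inE.
Qed.

(** Events given by a staircase array of indices, as the gap boxes of all
    clocks are: for each [c], the first [len c] variables of [c]. *)
Lemma mutually_independent_array (C : finType) (h : C -> nat -> I)
    (len : C -> nat) (B : C -> nat -> set T') :
  mutually_independent Z ->
  (forall c m c' m', h c m = h c' m' -> c = c' /\ m = m') ->
  (forall c m, measurable (B c m)) ->
  P [set w | forall c m, (m < len c)%N -> B c m (Z (h c m) w)] =
  \prod_c \prod_(m < len c) P (Z (h c m) @^-1` B c m).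
Proof.
move=> indep hinj mB.
pose s := [seq h c m | c <- enum C, m <- iota 0 (len c)].
(* [B] transported along the inverse of [h]; off the array, no condition. *)
pose B' i := if pselect (exists cm : C * nat, h cm.1 cm.2 = i) is left e
             then B (projT1 (cid e)).1 (projT1 (cid e)).2 else setT.
have B'E c m : B' (h c m) = B c m.
  rewrite /B'; case: pselect => [e|[]]; last by exists (c, m).
  by have [-> ->] := hinj _ _ _ _ (projT2 (cid e)).
have us : uniq s.
  apply: allpairs_uniq_dep => [|c _|]; [exact: enum_uniq|exact: iota_uniq|].
  by move=> [c m] [c' m'] _ _ /= /hinj [-> ->].
have mB' i : measurable (B' i) by rewrite /B'; case: pselect.
have := mutually_independent_seq indep us mB'.
rewrite /s big_allpairs_dep big_enum /=.
have -> : [set w | forall i, i \in s -> B' i (Z i w)] =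
    [set w | forall c m, (m < len c)%N -> B c m (Z (h c m) w)].
  apply/seteqP; split=> w H /=.
    move=> c m mc; rewrite -B'E; apply: H.
    by apply/allpairsPdep; exists c, m; rewrite mem_enum mem_iota.
  move=> i /allpairsPdep[c [m [_]]]; rewrite mem_iota => /andP[_ mc] ->.
  by rewrite B'E; exact: H.
move=> ->; apply: eq_bigr => c _.
rewrite -{1}(subn0 (len c)) -/(index_iota 0 (len c)) big_mkord.
by apply: eq_bigr => m _; rewrite B'E.
Qed.

End Independence.

(** * Laws of finite strings of counts *)
Section FiniteStrings.
Context (R : realType) (J : finType).

(** Coding strings by natural numbers makes every function of a string
    measurable, as all subsets of [nat] are. *)
Definition string_code d (T : measurableType d) (U : J -> T -> nat) (w : T) : nat :=
  choice.pickle [ffun j => U j w].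

Definition decoded (F : {ffun J -> nat} -> R) (n : nat) : R :=
  if pickle_inv n is Some g then F g else 0.

Lemma decodedK d (T : measurableType d) (U : J -> T -> nat) F :
  decoded F \o string_code U = (fun w => F [ffun j => U j w]).
Proof. by apply/funext => w; rewrite /decoded /string_code /= pickleK_inv. Qed.

Lemma decoded_le F M : (forall g, `|F g| <= M) -> forall n, `|decoded F n| <= M.
Proof.
move=> FM n; rewrite /decoded; case: pickle_inv => //.
by rewrite normr0 (le_trans _ (FM [ffun=> 0%N])).
Qed.

Lemma string_code_preimage d (T : measurableType d) (U : J -> T -> nat) n :
  string_code U @^-1` [set n] =
  if pickle_inv n is Some g then
    (if choice.pickle g == n then [set w | forall j, U j w = (g : {ffun J -> nat}) j]
     else set0)
  else set0.
Proof.
have := @pickleK_inv {ffun J -> nat}.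
case E: (pickle_inv n) => [g|] K.
  case: eqP => [gn|ne].
    apply/seteqP; split=> w /=.
      rewrite -gn => /(pcan_inj K) Ug j.
      by rewrite -Ug ffunE.
    by move=> Ug; rewrite -gn; congr choice.pickle; apply/ffunP => j; rewrite ffunE.
  apply/seteqP; split=> // w /= Un; apply: ne.
  by move: E; rewrite -Un /string_code K => -[<-].
by apply/seteqP; split=> // w /= Un; move: E; rewrite -Un /string_code K.
Qed.

Lemma measurable_string d (T : measurableType d) (U : J -> T -> nat) F :
  (forall g : {ffun J -> nat}, measurable [set w | forall j, U j w = g j]) ->
  measurable_fun setT (fun w => F [ffun j => U j w] : R).
Proof.
move=> mU; rewrite -(decodedK U F); apply: (@measurableT_comp _ _ _ _ nat) => //.
move=> _ B _; rewrite setTI.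
rewrite (_ : _ @^-1` B = \bigcup_(n in B) string_code U @^-1` [set n]); last first.
  by apply/seteqP; split=> [x Bx|x [n Bn /= Vn]]; [exists (string_code U x)|rewrite /= Vn].
apply: bigcup_measurable => n _; rewrite string_code_preimage.
by case: pickle_inv => // g; case: ifP.
Qed.

Lemma expectation_string d1 (T1 : measurableType d1) (P1 : probability T1 R)
    d2 (T2 : measurableType d2) (P2 : probability T2 R)
    (U1 : J -> T1 -> nat) (U2 : J -> T2 -> nat) F M :
  (forall g : {ffun J -> nat}, measurable [set w | forall j, U1 j w = g j]) ->
  (forall g : {ffun J -> nat}, measurable [set w | forall j, U2 j w = g j]) ->
  (forall g : {ffun J -> nat}, P1 [set w | forall j, U1 j w = g j] =
     P2 [set w | forall j, U2 j w = g j]) ->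
  (forall g, `|F g| <= M) ->
  ('E_P1[fun w => F [ffun j => U1 j w]] = 'E_P2[fun w => F [ffun j => U2 j w]])%E.
Proof.
move=> m1 m2 PE FM; rewrite -(decodedK U1 F) -(decodedK U2 F).
apply: (@expectation_discrete R _ _ _ _ _ _ _ _ _ M) => [n|n|n|].
- by rewrite string_code_preimage; case: pickle_inv => // g; case: ifP.
- by rewrite string_code_preimage; case: pickle_inv => // g; case: ifP.
- rewrite !string_code_preimage; case: pickle_inv => [g|]; last by rewrite !measure0.
  by case: ifP => // _; rewrite !measure0.
- exact: decoded_le.
Qed.

End FiniteStrings.

Section Mesh.
Context (R : realType) (a : R) (a0 : 0 < a).

Definition gaps (C : Type) (t : C * nat -> R) (c : C) (m : nat) : nat :=
  Num.truncn (t (c, m) / a).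

(** The values of waiting time [m] that satisfy clause [m] of the box [g]. *)
Definition gap_set (g : seq nat * nat) (m : nat) : set R :=
  if (m < size g.1)%N
  then [set` `[(nth 0%N g.1 m)%:R * a, (nth 0%N g.1 m).+1%:R * a[]
  else [set` `[g.2%:R * a, +oo[].

Lemma measurable_gap_set g m : measurable (gap_set g m).
Proof. by rewrite /gap_set; case: ifP. Qed.

Lemma in_gap_boxE (C : Type) (t : C * nat -> R) c g : (forall m, 0 <= t (c, m)) ->
  in_gap_box (gaps t c) g <->
  (forall m, (m < (size g.1).+1)%N -> gap_set g m (t (c, m))).
Proof.
move=> t0.
have ta0 m : 0 <= t (c, m) / a by rewrite divr_ge0// ltW.
split=> [[H1 H2] m|H]; rewrite /gap_set.
  rewrite ltnS leq_eqVlt => /predU1P[->|mg].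
    rewrite ltnn /= in_itv/= andbT -ler_pdivlMr//.
    by rewrite -truncn_ge_nat.
  rewrite mg /= in_itv/= -ler_pdivlMr// -ltr_pdivrMr// -(H1 _ mg).
  exact: truncn_itv.
split=> [m mg|].
  have := H m; rewrite /gap_set ltnS (ltnW mg) mg => /(_ isT) /=.
  rewrite in_itv/= -ler_pdivlMr// -ltr_pdivrMr// => /andP[h1 h2].
  exact: truncn_between.
have := H _ (ltnSn _); rewrite /gap_set ltnn /= in_itv/= andbT.
by rewrite -ler_pdivlMr// -truncn_ge_nat//; apply.
Qed.

Context (q : R) (aq : expR (- a) = 1 - q).

Lemma expR_mesh n : expR (- (n%:R * a)) = (1 - q) ^+ n.
Proof. by rewrite -mulrN mulrC expRM_natr aq. Qed.

(** The lack of memory of the exponential law: a waiting time exceeds [n] meshes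
    with probability (1 - q)^n. *)
Lemma gap_set_prob (Q : probability R R) g m :
  (forall B : set R, measurable B -> Q B = exponential_prob 1 B) ->
  (m <= size g.1)%N ->
  Q (gap_set g m) =
  (if (m < size g.1)%N then q * (1 - q) ^+ nth 0%N g.1 m else (1 - q) ^+ g.2)%:E.
Proof.
move=> QE mg; rewrite /gap_set; case: ifP => ml.
  rewrite exp_slab//.
  - by rewrite !expR_mesh; congr EFin; rewrite exprS; ring.
  - by rewrite mulr_ge0// ltW.
  - by rewrite ler_pM2r// ler_nat.
by rewrite exp_tail// ?expR_mesh// mulr_ge0// ltW.
Qed.

(** Why gaps and counts have the same law: in both products each ring contributes
    a factor [q] and each step a factor [1 - q]. *)
Lemma gap_box_prod (x : nat -> nat) L :
  let g := gap_code x L in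
  \prod_(m < (size g.1).+1)
    (if (m < size g.1)%N then q * (1 - q) ^+ nth 0%N g.1 m else (1 - q) ^+ g.2) =
  \prod_(n < L) ((1 - q) * q ^+ x n).
Proof.
move=> g; rewrite big_ord_recr /= ltnn.
under eq_bigr => i _ do rewrite ltn_ord.
rewrite big_split /= prodr_const card_ord prodrXr.
rewrite [RHS]big_split /= prodr_const card_ord prodrXr -(gap_code_size x L) -/g.
rewrite -mulrA -exprD mulrC; congr (_ ^+ _ * _).
rewrite -[in RHS](gap_code_sum x L) -/g; congr (_ + _)%N.
by rewrite sumnE (big_nth 0%N) big_mkord.
Qed.

End Mesh.

Lemma measurable_forall d (T : measurableType d) (I : countType) (A : I -> set T) :
  (forall i, measurable (A i)) -> measurable [set w | forall i, A i w].
Proof.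
move=> mA.
rewrite (_ : [set w | _] = \bigcap_n (if pickle_inv n is Some i then A i else setT)).
  by apply: bigcap_measurableType => n _; case: pickle_inv.
apply/seteqP; split=> [w H n _|w H i].
  by case: pickle_inv.
by have := H (choice.pickle i) Logic.I; rewrite pickleK_inv.
Qed.

Section CountStrings.
Context (R : realType) (C : finType) (L : nat).

Definition extend0 (g : {ffun C * 'I_L -> nat}) (c : C) (n : nat) : nat :=
  if insub n is Some i then g (c, i) else 0%N.

Lemma extend0E g c (i : 'I_L) : extend0 g c i = g (c, i).
Proof. by rewrite /extend0 valK. Qed.

Definition string_mass (q : R) (g : {ffun C * 'I_L -> nat}) : R :=
  \prod_c \prod_(n < L) ((1 - q) * q ^+ extend0 g c n).

Lemma geometric_string_prob d (T : measurableType d) (P : probability T R)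
    (I : choiceType) (xi : I -> {RV P >-> nat}) (h : C -> nat -> I) (q : R)
    (g : {ffun C * 'I_L -> nat}) :
  mutually_independent xi ->
  (forall c m c' m', h c m = h c' m' -> c = c' /\ m = m') ->
  (forall i x, distribution P (xi i) [set x] = ((1 - q) * q ^+ x)%:E) ->
  measurable [set w | forall j : C * 'I_L, xi (h j.1 j.2) w = g j] /\
  P [set w | forall j : C * 'I_L, xi (h j.1 j.2) w = g j] = (string_mass q g)%:E.
Proof.
move=> indep hinj law.
split.
  apply: measurable_forall => j.
  exact: (measurable_funPTI (xi (h j.1 j.2)) (Y := [set g j])).
have -> : [set w | forall j : C * 'I_L, xi (h j.1 j.2) w = g j] =
    [set w | forall c m, (m < L)%N -> [set extend0 g c m] (xi (h c m) w)].
  apply/seteqP; split=> w H /=.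
    by move=> c m mL; rewrite -[m]/(nat_of_ord (Ordinal mL)) extend0E -H.
  by move=> [c i] /=; rewrite (H c i) ?extend0E.
apply: etrans (mutually_independent_array (B := fun c m => [set extend0 g c m])
  (fun=> L) indep hinj _) _ => //.
rewrite /string_mass -prodEFin; apply: eq_bigr => c _.
by rewrite -prodEFin; apply: eq_bigr => m _; exact: law.
Qed.

End CountStrings.

Section WaitingTimes.
Context (R : realType) (C : finType) d (T : measurableType d) (P : probability T R).
Context (tau : C * nat -> {RV P >-> R}).
Hypothesis tau_law : forall c (B : set R), measurable B ->
  distribution P (tau c) B = exponential_prob 1 B.
Hypothesis tau_indep : mutually_independent tau.

(** Infinitely many waiting times that are at least 1 give infinitely many
    nonzero gaps, in any mesh [a <= 1]. *)
Definition good_times (t : C * nat -> R) : Prop :=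
  (forall i, 0 < t i) /\
  (forall c j0, exists2 j, (j0 <= j)%N & 1 <= t (c, j)).

Lemma good_endless a t c : 0 < a <= 1 -> good_times t -> endless (gaps a t c).
Proof.
move=> /andP[a0 a1] [_ H]; elim=> [|n [m nm]]; first by exists 0%N.
have [j mj tj] := H c m.+1; exists j.
case: j mj tj => // j mj tj; rewrite ring_stepS -addn1 leq_add//.
  exact: leq_trans nm (ring_step_le _ _).
by rewrite /gaps truncn_gt0 ler_pdivlMr// mul1r (le_trans a1).
Qed.

Lemma ae_countable (I : countType) (Q : I -> T -> Prop) :
  (forall i, {ae P, forall w, Q i w}) -> {ae P, forall w, forall i, Q i w}.
Proof.
move=> H.
have : {ae P, forall w, forall n : nat,
    if pickle_inv n is Some i then Q i w else True}.
  by apply: ae_foralln => n; case: pickle_inv => //; exact: aeW.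
apply: filterS => w /= Hw i.
by have := Hw (choice.pickle i); rewrite pickleK_inv.
Qed.

(** [M] consecutive waiting times are all less than 1 with probability
    (1 - exp (- 1))^M, which tends to 0. *)
Lemma good_times_ae : {ae P, forall w, good_times (tau^~ w)}.
Proof.
have pos : {ae P, forall w, forall i, 0 < tau i w}.
  apply: ae_countable => i; exists (tau i @^-1` `]-oo, 0]); split.
  - by rewrite -[X in measurable X]setTI; exact: measurable_funP.
  - exact: (exp_le0 (Q := distribution P (tau i)) (tau_law i)).
  - by move=> w /= /negP; rewrite -leNgt in_itv.
have rec : {ae P, forall w, forall i : C * nat, exists2 j, (i.2 <= j)%N & 1 <= tau (i.1, j) w}.
  apply: ae_countable => -[c j0] /=.
  pose A M := [set w | forall (u : unit) m, (m < M)%N -> `]-oo, (1:R)[%classic (tau (c, j0 + m)%N w)].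
  pose z : R := 1 - expR (- 1).
  have AE M : A M = \bigcap_(m in [set m | (m < M)%N]) (tau (c, j0 + m)%N @^-1` `]-oo, (1:R)[%classic).
    by apply/seteqP; split=> w H; [move=> m mM; exact: (H tt)|move=> _ m mM; exact: (H m mM)].
  have mA M : measurable (A M).
    rewrite AE; apply: bigcap_measurableType => i _.
    by rewrite -[X in measurable X]setTI; exact: measurable_funP.
  have PA M : P (A M) = (z ^+ M)%:E.
    apply: etrans (mutually_independent_array (h := fun (u : unit) m => (c, (j0 + m)%N))
      (B := fun _ _ => `]-oo, (1:R)[%classic) (fun=> M) tau_indep _ _) _ => //.
      by move=> [] m [] m' [] /addnI.
    rewrite big_const card_unit /= mule1.
    under eq_bigr => m _.
      rewrite (_ : P _ = z%:E); first over.
      rewrite (_ : `]-oo, (1:R)[%classic = ~` `[1, +oo[%classic); last by rewrite setCitvr.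
      have := probability_setC (distribution P (tau (c, j0 + m)%N))
        (measurable_itv `[(1 : R), +oo[).
      by rewrite (exp_tail (tau_law _) ler01).
    by rewrite prodEFin prodr_const card_ord.
  exists (\bigcap_M A M); split.
  - exact: bigcap_measurableType.
  - apply/eqP; rewrite -measure_le0; apply/lee_addgt0Pr => e e0; rewrite add0e.
    have z1 : `|z| < 1.
      have ez : expR (- 1) <= 1 :> R by rewrite expR_le1 oppr_le0.
      rewrite ger0_norm; last by rewrite /z subr_ge0.
      by rewrite /z gtrBl expR_gt0.
    have /cvgr0Pnorm_lt /(_ _ e0) [M _ /(_ _ (leqnn M))] := cvg_geometric 1 z1.
    rewrite /geometric /= mul1r => zM.
    apply: (@le_trans _ _ (P (A M))).
      by apply: le_measure; rewrite ?inE//; [exact: bigcap_measurableType|exact: bigcap_inf].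
    by rewrite PA lee_fin (le_trans (ler_norm _))// ltW.
  - move=> w /= Hw M _ _ m mM /=; rewrite in_itv/= ltNge; apply/negP => h.
    by apply: Hw; exists (j0 + m)%N => //; exact: leq_addr.
apply: filterS2 pos rec => w h1 h2; split=> // c j0; exact: (h2 (c, j0)).
Qed.

(** A modification on a null set makes the statements on trajectories true
    everywhere, so that counts and boxes are the same events. *)
Lemma good_version : exists t : T -> C * nat -> R,
  [/\ forall w, good_times (t w),
      {ae P, forall w, t w = tau^~ w} &
      forall i (B : set R), measurable B -> measurable [set w | B (t w i)]].
Proof.
have [N [mN N0 gN]] := good_times_ae.
exists (fun w i => if w \in N then 1 else tau i w); split=> [w||i B mB].
- case: (boolP (w \in N)) => [_|/negP wN]; first by split=> // c j0; exists j0.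
  by apply: contrapT => wg; apply: wN; apply: mem_set; exact: gN.
- exists N; split=> // w /= Hw; apply: contrapT => wN; apply: Hw.
  by apply/funext => i; rewrite memNset.
rewrite (_ : [set w | _] = (N `&` [set w | B 1]) `|` (~` N `&` tau i @^-1` B)).
  apply: measurableU; apply: measurableI => //.
  - rewrite (_ : [set w | B 1] = if pselect (B 1) then setT else set0).
      by case: pselect => b1 /=; [exact: measurableT|exact: measurable0].
    by apply/seteqP; split=> w /=; case: pselect.
  - exact: measurableC.
  - exact: measurable_funPTI.
apply/seteqP; split=> w /=.
  by case: ifPn => [/set_mem|/negP] wN Bw; [left|right; split=> // /mem_set].
by case=> -[wN]; [rewrite mem_set|rewrite memNset].
Qed.

Lemma ae_eq_probability (A B : set T) : measurable A -> measurable B ->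
  {ae P, forall w, A w <-> B w} -> P A = P B.
Proof.
move=> mA mB AB; rewrite -!expectation_indic// unlock.
apply: ae_eq_integral_any; apply: filterS AB => w ABw; rewrite !indicE.
by congr ((nat_of_bool _)%:R%:E); apply/idP/idP; rewrite !inE => /ABw.
Qed.

(** The numbers of rings in the successive steps, for exponential waiting times
    measured in the mesh [a], have the law of the noise of the discrete
    process with parameter [q]. *)
Lemma count_string_prob (a q : R) (t : T -> C * nat -> R) (L : nat)
    (g : {ffun C * 'I_L -> nat}) :
  0 < a <= 1 -> expR (- a) = 1 - q ->
  (forall w, good_times (t w)) -> {ae P, forall w, t w = tau^~ w} ->
  (forall i (B : set R), measurable B -> measurable [set w | B (t w i)]) ->
  measurable [set w | forall j : C * 'I_L, rings_at (gaps a (t w) j.1) j.2 = g j] /\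
  P [set w | forall j : C * 'I_L, rings_at (gaps a (t w) j.1) j.2 = g j] =
  (string_mass q g)%:E.
Proof.
move=> a01 aq tgood tae mt; have /andP[a0 a1] := a01.
pose gc c := gap_code (extend0 g c) L.
pose len c := (size (gc c).1).+1.
have -> : [set w | forall j : C * 'I_L, rings_at (gaps a (t w) j.1) j.2 = g j] =
    [set w | forall c m, (m < len c)%N -> gap_set a (gc c) m (t w (c, m))].
  apply/seteqP; split=> w H.
    move=> c; apply/(in_gap_boxE a0) => [m|]; first exact/ltW/(tgood w).1.
    apply/rings_at_box; first exact: good_endless.
    by move=> n nL; rewrite -[n]/(nat_of_ord (Ordinal nL)) extend0E -H.
  move=> [c i] /=; rewrite -extend0E.
  have : in_gap_box (gaps a (t w) c) (gc c).
    by apply/(in_gap_boxE a0) => [m|]; [exact/ltW/(tgood w).1|exact: H].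
  by move=> /rings_at_box -> //; exact: good_endless.
have mE (s : T -> C * nat -> R) :
    (forall i (B : set R), measurable B -> measurable [set w | B (s w i)]) ->
    measurable [set w | forall c m, (m < len c)%N -> gap_set a (gc c) m (s w (c, m))].
  move=> ms.
  rewrite (_ : [set w | _] = [set w | forall i : C * nat,
      (if (i.2 < len i.1)%N then [set w | gap_set a (gc i.1) i.2 (s w i)] else setT) w]).
    apply: measurable_forall => i; case: ifP => // _.
    by apply: ms; exact: measurable_gap_set.
  apply/seteqP; split=> w H.
    by move=> [c m] /=; case: ifP => // mc; exact: H.
  by move=> c m mc; have := H (c, m); rewrite /= mc.
have mtau : forall i (B : set R), measurable B -> measurable [set w | B (tau i w)].
  by move=> i B mB; exact: measurable_funPTI.
split; first exact: mE.
have -> : P [set w | forall c m, (m < len c)%N -> gap_set a (gc c) m (t w (c, m))] =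
    P [set w | forall c m, (m < len c)%N -> gap_set a (gc c) m (tau (c, m) w)].
  apply: ae_eq_probability; first exact: mE.
    exact: (mE (fun w i => tau i w)).
  by apply: filterS tae => w /= ->.
apply: etrans (mutually_independent_array (h := fun c m => (c, m))
  (B := fun c m => gap_set a (gc c) m) len tau_indep _ _) _ => //.
- by move=> c m c' m' [-> ->].
- by move=> c m; exact: measurable_gap_set.
rewrite /string_mass -prodEFin; apply: eq_bigr => c _.
rewrite -(gap_box_prod q) -prodEFin; apply: eq_bigr => m _.
apply: (gap_set_prob a0 aq (tau_law (c, m : nat)) (g := gc c)).
by rewrite -ltnS; exact: ltn_ord.
Qed.

End WaitingTimes.

(** * Distinct ring times *)
Section NoAtom.
Context (R : realType) d (T : measurableType d) (P : probability T R).
Context (I : choiceType) (Z : I -> {RV P >-> R}).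
Hypothesis Z_law : forall i (B : set R), measurable B ->
  distribution P (Z i) B = exponential_prob 1 B.
Hypothesis Z_indep : mutually_independent Z.

(** The density is at most 1. *)
Lemma exponential_itv_le (x y : R) : x <= y ->
  (exponential_prob 1 `[x, y]%classic <= (y - x)%:E)%E.
Proof.
move=> xy; rewrite /exponential_prob.
have -> : (y - x)%:E = (\int[lebesgue_measure]_(_ in `[x, y]%classic) 1)%E.
  rewrite integral_cst//= mul1e lebesgue_measure_itv/=.
  by move: xy; rewrite le_eqVlt lte_fin => /predU1P[->|->//]; rewrite ltxx subrr.
apply: ge0_le_integral => //.
- by move=> z _; rewrite lee_fin exponential_pdf_ge0.
- apply/measurable_EFinP/measurable_funTS; exact: measurable_exponential_pdf.
move=> z _; rewrite lee_fin; have [z0|z0] := leP 0 z.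
  by rewrite exponential_pdfE// mul1r mulN1r expR_le1 oppr_le0.
by rewrite lt0_exponential_pdf.
Qed.

Context (J : finType) (h : J -> I) (h_inj : injective h) (i0 : I).
Hypothesis hi0 : forall j, h j != i0.
Context (sg : J -> R).
Hypothesis sg1 : forall j, `|sg j| <= 1.

(** The combination of the [Z (h j)] is localised by cutting their values into
    intervals of length [e]: on the cell [f] it is at distance at most
    [#|J| * e] from [centre e f]. *)
Let cell (e : R) (f : {ffun J -> int}) : set T :=
  [set w | forall j, `[(f j)%:~R * e, (f j + 1)%:~R * e[%classic (Z (h j) w)].

Let centre (e : R) (f : {ffun J -> int}) : R := \sum_j sg j * ((f j)%:~R * e).

Let target (e : R) (f : {ffun J -> int}) : set R :=
  `[centre e f - #|J|%:R * e, centre e f + #|J|%:R * e]%classic.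

Let measurable_cell e f : measurable (cell e f).
Proof. by apply: measurable_forall => j; exact: measurable_funPTI. Qed.

Let measurable_target e f : measurable (Z i0 @^-1` target e f).
Proof. by apply: measurable_funPTI; exact: measurable_itv. Qed.

Let cell_prob e f : P (cell e f `&` Z i0 @^-1` target e f) =
  (P (cell e f) * exponential_prob 1 (target e f))%E.
Proof.
pose B i := if i == i0 then target e f else
  if [pick j | h j == i] is Some j then `[(f j)%:~R * e, (f j + 1)%:~R * e[%classic
  else setT.
have Bh j : B (h j) = `[(f j)%:~R * e, (f j + 1)%:~R * e[%classic.
  rewrite /B (negbTE (hi0 j)); case: pickP => [j' /eqP/h_inj -> //|/(_ j)].
  by rewrite eqxx.
have mB i : measurable (B i).
  rewrite /B; case: eqP => _; first exact: measurable_itv.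
  by case: [pick j | h j == i] => [j|]; [exact: measurable_itv|exact: measurableT].
have us : uniq [seq h j | j <- enum J] by rewrite map_inj_uniq// enum_uniq.
have us' : uniq (i0 :: [seq h j | j <- enum J]).
  rewrite /= us andbT; apply/mapP => -[j _ /eqP]; rewrite eq_sym.
  by rewrite (negbTE (hi0 j)).
have E1 := mutually_independent_seq Z_indep us mB.
have E2 := mutually_independent_seq Z_indep us' mB.
move: E2; rewrite big_cons -E1 muleC.
have -> : [set w | forall i, i \in [seq h j | j <- enum J] -> B i (Z i w)] = cell e f.
  apply/seteqP; split=> w H.
    by move=> j; rewrite -Bh; apply: H; rewrite map_f// mem_enum.
  by move=> i /mapP[j _ ->]; rewrite Bh; exact: H.
have -> : [set w | forall i, i \in i0 :: [seq h j | j <- enum J] -> B i (Z i w)] =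
    cell e f `&` Z i0 @^-1` target e f.
  apply/seteqP; split=> w H.
    split; last by have := H i0; rewrite inE eqxx /B eqxx => /(_ isT).
    by move=> j; rewrite -Bh; apply: H; rewrite inE map_f ?orbT// mem_enum.
  move=> i; rewrite inE => /predU1P[->|/mapP[j _ ->]].
    by rewrite /B eqxx; exact: H.2.
  by rewrite Bh; exact: H.1.
move=> ->; congr (_ * _)%E; rewrite /B eqxx.
exact: (Z_law i0 (measurable_itv _)).
Qed.

(** The cells are disjoint and on each of them [Z i0] is independent of the cell,
    so the probability is at most that of the worst target interval. *)
Let cover_prob (e : R) : 0 < e ->
  (P (\bigcup_n (if pickle_inv n is Some f then cell e f `&` Z i0 @^-1` target e f
      else set0)) <= (2 * #|J|%:R * e)%:E)%E.
Proof.
move=> e0.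
set F := fun n => if pickle_inv n is Some f then _ else set0.
pose G n := if pickle_inv n is Some f then
  (if choice.pickle f == n then cell e f else set0) else set0.
have mF n : measurable (F n).
  rewrite /F; case: pickle_inv => // f; exact: measurableI.
have mG n : measurable (G n) by rewrite /G; case: pickle_inv => // f; case: ifP.
have e20 : 0 <= 2 * #|J|%:R * e by rewrite !mulr_ge0// ltW.
have FG n : (P (F n) <= (2 * #|J|%:R * e)%:E * P (G n))%E.
  rewrite /F /G; have := @pickle_invK {ffun J -> int} n.
  case: pickle_inv => [f /= ->|_]; last by rewrite measure0 mule0.
  rewrite eqxx cell_prob muleC; apply: lee_wpmul2r => //.
  apply: le_trans (exponential_itv_le _) _.
    by rewrite lerBlDr -addrA lerDl addr_ge0// mulr_ge0// ltW.
  by rewrite lee_fin; lra.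
have tG : trivIset setT G.
  move=> i j _ _ [w []]; rewrite /G.
  case: pickle_inv => // f; case: eqP => // <- wf.
  case: pickle_inv => // g; case: eqP => // <- wg; congr choice.pickle.
  apply/ffunP => x; have := wf x; have := wg x; rewrite /= !in_itv/=.
  rewrite -!ler_pdivlMr// -!ltr_pdivrMr// => /floor_def <- /floor_def <-.
  by [].
apply: (@le_trans _ _ (\sum_(0 <= n <oo) P (F n))%E).
  by apply: measure_sigma_subadditive; [exact: mF|exact: bigcupT_measurable|move=> ?].
apply: (@le_trans _ _ (\sum_(0 <= n <oo) (2 * #|J|%:R * e)%:E * P (G n))%E).
  by apply: lee_nneseries.
rewrite nneseriesZl//.
have -> : (\sum_(0 <= n <oo) P (G n) = P (\bigcup_n G n))%E.
  by rewrite measure_bigcup//; apply: eq_eseriesl => i; rewrite in_setT.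
rewrite -[leRHS]mule1; apply: lee_wpmul2l; first by rewrite lee_fin.
apply: probability_le1; by apply: bigcup_measurable => ? _.
Qed.

(** An exponential variable avoids almost surely any combination of independent
    ones: the event is covered by the cells with their targets for every [e], and
    this cover has probability O(e). *)
Lemma no_atom : P.-negligible [set w | Z i0 w = \sum_j sg j * Z (h j) w].
Proof.
pose e n : R := n.+1%:R^-1.
have e0 n : 0 < e n by rewrite invr_gt0.
pose F e n : set T := if pickle_inv n is Some f then cell e f `&` Z i0 @^-1` target e f
      else set0.
have mF x : measurable (\bigcup_n F x n).
  apply: bigcup_measurable => n _; rewrite /F; case: pickle_inv => // f.
  exact: measurableI.
exists (\bigcap_p \bigcup_n F (e p) n); split.
- by apply: bigcap_measurableType => p _.
- apply/eqP; rewrite -measure_le0; apply/lee_addgt0Pr => x x0; rewrite add0e.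
  have [p px] : exists p : nat, 2 * #|J|%:R * e p <= x.
    have [n nx] : exists n : nat, 2 * #|J|%:R / x < n%:R.
      by exists (Num.truncn (2 * #|J|%:R / x)).+1; rewrite truncnS_gt.
    exists n; rewrite /e ler_pdivrMr// -ler_pdivrMl// mulrC.
    by rewrite (le_trans (ltW nx))// ler_nat.
  apply: (@le_trans _ _ (P (\bigcup_n F (e p) n))).
    by apply: le_measure; rewrite ?inE//; [exact: bigcap_measurableType|exact: bigcap_inf].
  by apply: le_trans (cover_prob (e0 p)) _; rewrite lee_fin.
move=> w /= Zw p _.
pose f : {ffun J -> int} := [ffun j => Num.floor (Z (h j) w / e p)].
have fP j : (f j)%:~R * e p <= Z (h j) w < (f j + 1)%:~R * e p.
  by rewrite -ler_pdivlMr// -ltr_pdivrMr// ffunE; exact: floor_itv.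
exists (choice.pickle f) => //; rewrite /F pickleK_inv; split.
  by move=> j /=; rewrite in_itv/=.
rewrite /preimage/= /target/= in_itv/= -ler_distl Zw /centre -sumrB.
apply: le_trans (ler_norm_sum _ _ _) _.
rewrite -sum1_card natr_sum mulr_suml; apply: ler_sum => j _.
rewrite -mulrBr normrM mul1r -[leRHS]mul1r; apply: ler_pM => //.
have /andP[h1 h2] := fP j.
by rewrite ger0_norm ?subr_ge0// lerBlDr; move: (ltW h2); rewrite intrD mulrDl mul1r addrC.
Qed.

End NoAtom.

Section DistinctRings.
Context (R : realType) (C : finType) d (T : measurableType d) (P : probability T R).
Context (tau : C * nat -> {RV P >-> R}).
Hypothesis tau_law : forall c (B : set R), measurable B ->
  distribution P (tau c) B = exponential_prob 1 B.
Hypothesis tau_indep : mutually_independent tau.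

(** Equality of the two ring times determines the first waiting time of [c'] from
    the others, with coefficients 1 for [c] and -1 for the rest of [c']. *)
Let distinct_sums c c' r r' : c != c' ->
  {ae P, forall w, \sum_(m < r.+1) tau (c, m : nat) w <> \sum_(m < r'.+1) tau (c', m : nat) w}.
Proof.
move=> cc'.
pose h (j : 'I_(r.+1 + r')) : C * nat :=
  match fintype.split j with inl m => (c, m : nat) | inr m => (c', m.+1) end.
have h_inj : injective h.
  move=> i j; rewrite /h -{2}(splitK i) -{2}(splitK j).
  case: (fintype.split i) (fintype.split j) => [m|m] [m'|m'] [].
  - by move=> /val_inj ->.
  - by move=> e; rewrite e eqxx in cc'.
  - by move=> e; rewrite e eqxx in cc'.
  - by move=> /val_inj ->.
have hi0 j : h j != (c', 0%N).
  by rewrite /h; case: (fintype.split j) => m; rewrite xpair_eqE ?(negbTE cc')// andbF.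
pose sg (j : 'I_(r.+1 + r')) : R := if fintype.split j is inl _ then 1 else -1.
have sg1 j : `|sg j| <= 1 by rewrite /sg; case: (fintype.split j) => _; rewrite ?normrN normr1.
have := no_atom tau_law tau_indep h_inj hi0 sg1.
apply: negligibleS => w /= /contrapT E.
rewrite big_split_ord /= /sg /h.
under eq_bigr => i _ do rewrite (unsplitK (inl i)) mul1r.
under [X in _ + X]eq_bigr => i _ do rewrite (unsplitK (inr i)) mulN1r.
by rewrite E big_ord_recl /= sumrN addrK.
Qed.

Lemma distinct_rings_ae : {ae P, forall w, forall c c' r r', c != c' ->
  \sum_(m < r.+1) tau (c, m : nat) w <> \sum_(m < r'.+1) tau (c', m : nat) w}.
Proof.
have : {ae P, forall w, forall i : C * C * (nat * nat), i.1.1 != i.1.2 ->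
    \sum_(m < i.2.1.+1) tau (i.1.1, m : nat) w <>
    \sum_(m < i.2.2.+1) tau (i.1.2, m : nat) w}.
  apply: ae_countable => -[[c c'] [r r']] /=.
  have [->|cc'] := eqVneq c c'; first exact: aeW.
  by have := @distinct_sums c c' r r' cc'; apply: filterS.
by apply: filterS => w H c c' r r'; exact: (H ((c, c'), (r, r'))).
Qed.

End DistinctRings.

(** * Time changes through prescribed points *)
Section Tents.
Context (R : realType) (J : finType) (S t : J -> R) (delta : R).
Hypothesis delta0 : 0 < delta.
Hypothesis S_ge : forall j, delta <= S j.
Hypothesis S_sep : forall i j, i != j -> delta <= `|S i - S j|.
Hypothesis t_close : \sum_j `|t j - S j| < delta.

Let tent (x : R) : R := Num.max 0 (1 - `|x| / delta).

(** The identity plus a tent of height [t j - S j] at each [S j].  The tents have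
    half-width [delta], so they vanish at 0 and at the other points, and the
    perturbation has Lipschitz constant less than 1. *)
Definition tent_change (x : R) : R := x + \sum_j (t j - S j) * tent (x - S j).

Let tent_out x : delta <= `|x| -> tent x = 0.
Proof. by move=> dx; apply/max_idPl; rewrite subr_le0 ler_pdivlMr// mul1r. Qed.

Let tent_le1 x : `|tent x| <= 1.
Proof.
rewrite /tent ger0_norm ?le_max ?lexx// ge_max ler01 /=.
by rewrite gerBl divr_ge0// ltW.
Qed.

Let tent_lip x y : `|tent x - tent y| <= `|x - y| / delta.
Proof.
have H (u v : R) : `|Num.max 0 u - Num.max 0 v| <= `|u - v|.
  have := ler_norm (u - v); have := lerNnormlW (lexx `|u - v|).
  by rewrite ler_norml !maxEle; case: (leP 0 u); case: (leP 0 v) => *; apply/andP; split; lra.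
apply: le_trans (H _ _) _.
rewrite (_ : _ - _ = (`|y| - `|x|) / delta); last by ring.
rewrite normrM (gtr0_norm (x := delta^-1)) ?invr_gt0// ler_pM2r ?invr_gt0//.
by rewrite distrC (le_trans (ler_dist_dist _ _)).
Qed.

Lemma tent_change_dist x : `|tent_change x - x| <= \sum_j `|t j - S j|.
Proof.
rewrite /tent_change addrAC subrr add0r; apply: le_trans (ler_norm_sum _ _ _) _.
by apply: ler_sum => j _; rewrite normrM ler_piMr.
Qed.

Lemma tent_change_at j : tent_change (S j) = t j.
Proof.
rewrite /tent_change (bigD1 j)//= subrr {1}/tent normr0 mul0r subr0.
rewrite big1 ?addr0; last first.
  by move=> i ij; rewrite tent_out ?mulr0// S_sep// eq_sym.
rewrite (_ : Num.max 0 1 = 1) ?mulr1 ?subrKC//.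
by apply/max_idPr; exact: ler01.
Qed.

Let slope := (\sum_j `|t j - S j|) / delta.

Let tent_change_lip x y :
  `|(tent_change x - x) - (tent_change y - y)| <= slope * `|x - y|.
Proof.
have E z : tent_change z - z = \sum_j (t j - S j) * tent (z - S j).
  by rewrite /tent_change addrAC subrr add0r.
rewrite !E -sumrB.
apply: le_trans (ler_norm_sum _ _ _) _; rewrite /slope mulr_suml mulr_suml.
apply: ler_sum => j _; rewrite -mulrBr normrM -mulrA ler_wpM2l//.
by apply: le_trans (tent_lip _ _) _; rewrite opprB addrA subrK mulrC.
Qed.

Let slope1 : slope < 1.
Proof. by rewrite /slope ltr_pdivrMr// mul1r. Qed.

Let slope0 : 0 <= slope.
Proof. by rewrite divr_ge0 ?sumr_ge0// ltW. Qed.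

Let tent_change0 : tent_change 0 = 0.
Proof.
rewrite /tent_change add0r big1// => j _; rewrite tent_out ?mulr0// add0r normrN.
by rewrite (le_trans (S_ge j))// ler_norm.
Qed.

Lemma tent_change_time : time_change tent_change.
Proof.
have mono x y : x < y -> tent_change x < tent_change y.
  move=> xy; have := tent_change_lip x y.
  rewrite (distrC x y) (gtr0_norm (x := y - x)) ?subr_gt0// => h.
  have : slope * (y - x) < y - x by rewrite -[ltRHS]mul1r ltr_pM2r// subr_gt0.
  by move: h; rewrite ler_norml => /andP[_]; lra.
split=> [s u _|]; first exact: mono.
apply/seteqP; split=> [_ [x /= x0 <-]|v /= v0].
  rewrite -tent_change0; move: x0; rewrite le_eqVlt => /predU1P[->//|/mono/ltW//].
pose D := \sum_j `|t j - S j|.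
have D0 : 0 <= D by rewrite sumr_ge0.
have cont : continuous tent_change.
  move=> x; apply/cvgrPdist_lt => e e0; near=> y.
  have xy : `|x - y| < e / 2.
    near: y; apply: (cvgr_dist_lt (fun z : R => z)) => //; exact: divr_gt0.
  have := tent_change_lip x y => h.
  have : slope * `|x - y| <= `|x - y| by rewrite ler_piMl// ltW.
  rewrite (_ : tent_change x - tent_change y =
    (tent_change x - x - (tent_change y - y)) + (x - y)); last by ring.
  by move=> h2; apply: le_lt_trans (ler_normD _ _) _; lra.
have [|||c + <-] := @IVT R tent_change 0 (v + D) v.
- by rewrite addr_ge0.
- exact: continuous_subspaceT.
- rewrite tent_change0; apply/andP; split; first by rewrite ge_min v0.
  have := tent_change_dist (v + D); rewrite -/D ler_norml => /andP[h _].
  by rewrite le_max; apply/orP; right; lra.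
by rewrite in_itv/= => /andP[c0 _]; exists c.
Unshelve. all: by end_near. Qed.

End Tents.

(** * The jump process read on the grid *)
Section Trajectory.
Context (R : realType) (k : nat) (t : clock k * nat -> R) (y : R -> config k).
Hypothesis t_pos : forall i, 0 < t i.
Hypothesis y_driven : driven_by t y.

Lemma ring_timeS c m : ring_time t c m.+1 = ring_time t c m + t (c, m.+1).
Proof. by rewrite /ring_time big_ord_recr. Qed.

Lemma ring_time_lt c m m' : (m < m')%N -> ring_time t c m < ring_time t c m'.
Proof.
elim: m' => // m' IH; rewrite ltnS leq_eqVlt => /predU1P[->|/IH h].
  by rewrite ring_timeS ltrDl.
by rewrite ring_timeS (lt_trans h)// ltrDl.
Qed.

Lemma ring_time_le c m m' : (m <= m')%N -> ring_time t c m <= ring_time t c m'.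
Proof. by rewrite leq_eqVlt => /predU1P[->//|/ring_time_lt/ltW]. Qed.

Lemma ring_time_gt0 c m : 0 < ring_time t c m.
Proof.
elim: m => [|m IH]; first by rewrite /ring_time big_ord1.
by rewrite ring_timeS addr_gt0.
Qed.

Context (N : nat) (a : R) (lam : R -> R) (M : nat) (T : R).
Hypothesis N0 : (0 < N)%N.
Hypothesis lamP : time_change lam.
Hypothesis gaps_endless : forall c, endless (gaps a t c).
Let n c m := ring_step (gaps a t c) m.
Hypothesis lam_ring : forall c m, (m <= M)%N ->
  lam (ring_time t c m) = (n c m).+1%:R / N%:R.
Hypothesis T_lt : forall c, T < ring_time t c M.
Hypothesis ring_distinct : forall c c' m m', (m <= M)%N -> (m' <= M)%N ->
  ring_time t c m = ring_time t c' m' -> c = c' /\ m = m'.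

Let xi : noise k := fun i => rings_at (gaps a t (i.1.1, i.2)) i.1.2.

Let N0' : 0 < N%:R :> R. Proof. by rewrite ltr0n. Qed.

Let clk s := Num.truncn (N%:R * lam s).

Let clk_ge (m : nat) s : 0 <= s -> (m <= clk s)%N = (m%:R / N%:R <= lam s).
Proof.
move=> s0; rewrite truncn_ge_nat ?mulr_ge0 ?(time_change_ge0 lamP)//.
by rewrite ler_pdivrMr// mulrC.
Qed.

Let ring_before c m s : (m <= M)%N -> 0 <= s ->
  (ring_time t c m <= s) = (n c m < clk s)%N.
Proof.
move=> mM s0; rewrite clk_ge// -lam_ring//.
apply/idP/idP => [h|]; first exact: time_change_le (ltW (ring_time_gt0 c m)) h.
rewrite leNgt => h; rewrite leNgt; apply/negP => h2; apply: (negP h).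
exact: lamP.1.
Qed.

(** Only the first [M] rings of each clock matter up to time [T]. *)
Let ring_small c m s : s <= T -> ring_time t c m <= s -> (m <= M)%N.
Proof.
move=> sT h; rewrite leqNgt; apply/negP => /ltnW /(ring_time_le c) h2.
by have := T_lt c; rewrite ltNge (le_trans h2 (le_trans h sT)).
Qed.

Let no_ring s s' : 0 <= s -> s <= s' -> s' <= T ->
  (forall c m, (m <= M)%N -> (clk s <= n c m)%N -> (n c m < clk s')%N -> False) ->
  y s' = y s.
Proof.
move=> s0 ss' sT H; have [_ + _] := y_driven; apply => // c m [h1 h2].
have mM := ring_small sT h2.
apply: (H c m mM); last by rewrite -ring_before// (le_trans s0).
by rewrite leqNgt -ring_before// -ltNge.
Qed.

Let ring_inj c c' m m' : (m <= M)%N -> (m' <= M)%N -> n c m = n c' m' ->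
  c = c' /\ m = m'.
Proof.
move=> mM m'M e; apply: ring_distinct => //.
have E : lam (ring_time t c m) = lam (ring_time t c' m') by rewrite !lam_ring// e.
apply/eqP; rewrite eq_le !leNgt; apply/andP; split; apply/negP => h.
  by have := lamP.1 _ _ (ltW (ring_time_gt0 _ _)) h; rewrite E ltxx.
by have := lamP.1 _ _ (ltW (ring_time_gt0 _ _)) h; rewrite E ltxx.
Qed.

(** The time change sends ring [m] of clock [c] to the end of its step, so that
    at time [s] the steps completed by the discrete process contain exactly the
    rings up to time [s].  By induction on the number of completed steps, the
    last step contains no ring and both processes stay, or a single ring and both
    jump. *)
Lemma trajectory_eq s : 0 <= s -> s <= T ->
  y s = X xi (Num.truncn (N%:R * lam s)).
Proof.
suff H m : forall s, 0 <= s -> s <= T -> clk s = m ->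
    y s = X xi m /\ ordered (X xi m).
  by move=> s0 sT; have [] := H _ _ s0 sT erefl.
elim: m => [|m IH] {}s s0 sT sm.
  split; last exact: ordered0.
  rewrite (@no_ring 0 s)//; first by have [->] := y_driven.
  by move=> c m mM _; rewrite sm.
have lms : m.+1%:R / N%:R <= lam s by rewrite -clk_ge// sm.
have lms' : m%:R / N%:R < lam s.
  by apply: lt_le_trans lms; rewrite ltr_pM2r ?invr_gt0// ltr_nat.
have m0 : 0 <= m%:R / N%:R :> R by rewrite divr_ge0.
have [s1 s10 ls1] := time_change_onto lamP m0.
have s1s : s1 < s by apply: (time_change_lt lamP) => //; rewrite ls1.
have s1T : s1 <= T by rewrite (le_trans (ltW s1s)).
have cs1 : clk s1 = m.
  by rewrite /clk ls1 mulrCA divff ?gt_eqF// mulr1 natrK.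
have [ys1 om] := IH _ s10 s1T cs1.
(* Later rings have not entered the completed steps. *)
have late c i : (M < i)%N -> (m < n c i)%N.
  move=> Mi; apply: (@leq_trans (n c M)); last exact: ring_step_le (ltnW Mi).
  rewrite ltnNge -ltnS -sm -ring_before// -ltNge.
  by apply: le_lt_trans sT (T_lt c).
have [[[c i] [iM nci]]|none] :=
    pselect (exists ci : clock k * nat, (ci.2 <= M)%N /\ n ci.1 ci.2 = m); last first.
  have none' c i : n c i != m.
    apply/eqP => e; apply: none; exists (c, i); split=> //=.
    by rewrite leqNgt; apply/negP => /(late c); rewrite e ltnn.
  have -> : X xi m.+1 = X xi m.
    apply: X_step_id => // p b; rewrite /xi /=.
    by apply: rings_at_none => // i; exact: none'.
  split=> //; rewrite -ys1; apply: no_ring => //; first exact: ltW.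
  move=> c j jM; rewrite cs1 sm ltnS => h1 h2.
  by have := none' c j; rewrite eqn_leq h1 h2.
rewrite /= in iM nci.
have uniq_ring c' j : n c' j = m -> c' = c /\ j = i.
  move=> e; have jM : (j <= M)%N.
    by rewrite leqNgt; apply/negP => /(late c'); rewrite e ltnn.
  by apply: ring_inj => //; rewrite e nci.
have XE : X xi m.+1 = jump c (X xi m).
  apply: X_step_jump => // p b; rewrite /xi /=.
  have [e|ne] := eqVneq (p, b) c.
    apply: (@rings_at_one _ _ i) => // j; apply/eqP/eqP => [|->].
      by rewrite e => /uniq_ring[].
    by rewrite e.
  apply: rings_at_none => // j; apply/eqP => /uniq_ring[e _].
  by rewrite e eqxx in ne.
rewrite XE; split; last exact: jump_ordered.
pose sig := ring_time t c i.
have sig0 : 0 < sig := ring_time_gt0 c i.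
have csig : clk sig = m.+1.
  by rewrite /clk /sig lam_ring// nci mulrCA divff ?gt_eqF// mulr1 natrK.
have sigs : sig <= s by rewrite ring_before// nci sm.
have -> : y s = y sig.
  apply: no_ring => //; first exact: ltW.
  by move=> c' j jM; rewrite csig sm => h1; rewrite ltnNge h1.
have [_ _ /(_ c i) yjump] := y_driven.
have s1sig : s1 < sig.
  apply: (time_change_lt lamP); first exact: ltW.
  by rewrite ls1 /sig lam_ring// nci ltr_pM2r ?invr_gt0// ltr_nat.
have : \forall s2 \near sig^'-, [/\ s1 < s2, s2 < sig & y sig = jump c (y s2)].
  near=> s2; split.
  - near: s2; exact: nbhs_left_gt.
  - near: s2; exact: nbhs_left_lt.
  - near: s2; exact: yjump.
move=> /filter_ex[s2 [h1 h2 ys]]; rewrite ys.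
have s20 : 0 <= s2 by rewrite (le_trans s10)// ltW.
have s2T : s2 <= T by rewrite (le_trans (ltW h2))// (le_trans sigs).
suff cs2 : clk s2 = m by have [->] := IH _ s20 s2T cs2.
apply/eqP; rewrite eqn_leq clk_ge// -ls1 (time_change_le lamP)// ?(ltW h1)// andbT.
by rewrite leqNgt -nci -ring_before// -ltNge.
Unshelve. all: by end_near. Qed.

End Trajectory.

(** * Almost sure convergence of the coupled paths *)
Section Meshes.
Context (R : realType).

(** An exponential waiting time exceeds this length with probability [1 - 1 / N]. *)
Definition mesh (N : nat) : R := - ln (1 - N%:R^-1).

Lemma inv_nat_itv N : (2 <= N)%N -> 0 < (N%:R^-1 : R) < 1.
Proof.
move=> N2; have N0 : 0 < N%:R :> R by rewrite ltr0n (leq_trans _ N2).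
by rewrite invr_gt0 N0 invf_lt1// ltr1n.
Qed.

Lemma expR_meshN N : (2 <= N)%N -> expR (- mesh N) = 1 - N%:R^-1.
Proof.
move=> /inv_nat_itv/andP[_ h]; rewrite /mesh opprK lnK//.
by rewrite posrE subr_gt0.
Qed.

Lemma mesh_ge N : (2 <= N)%N -> N%:R^-1 <= mesh N.
Proof.
move=> N2; have := expR_ge1Dx (- N%:R^-1 : R); rewrite -expR_meshN// ler_expR.
by rewrite lerN2.
Qed.

Lemma mesh_mul_le N : (2 <= N)%N -> mesh N * (1 - N%:R^-1) <= N%:R^-1.
Proof.
move=> N2; have /andP[q0 q1] := inv_nat_itv N2.
have p0 : 0 < 1 - N%:R^-1 :> R by rewrite subr_gt0.
rewrite -ler_pdivlMr// -ler_expR -[expR (mesh N)]invrK -expRN expR_meshN//.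
apply: le_trans (expR_ge1Dx _).
by rewrite -[leLHS]mul1r ler_pdivrMr// mulrDl mul1r mulfVK ?gt_eqF// subrK.
Qed.

Lemma mesh_itv N : (2 <= N)%N -> 0 < mesh N <= 1.
Proof.
move=> N2; have /andP[q0 q1] := inv_nat_itv N2.
rewrite (lt_le_trans q0 (mesh_ge N2)) /=.
have N0 : 0 < N%:R :> R by rewrite ltr0n (leq_trans _ N2).
have q2 : N%:R^-1 <= 1 / 2 :> R.
  by rewrite mul1r lef_pV2 ?posrE// ler_nat.
have := mesh_mul_le N2; have := mesh_ge N2; move: q2 q0.
move: (mesh N) (N%:R^-1 : R) => m q q2 q0 h1 h2.
rewrite leNgt; apply/negP => m1.
have : 1 - q < m * (1 - q) by rewrite -[ltLHS]mul1r ltr_pM2r//; lra.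
by lra.
Qed.

(** Each of the [m.+1] integer parts loses less than one mesh, and the mesh differs
    from [1 / N] by a relative error of order [1 / N]. *)
Lemma ring_step_dist (C : Type) (t : C * nat -> R) c m N : (2 <= N)%N ->
  (forall i, 0 < t i) ->
  `|(ring_step (gaps (mesh N) t c) m).+1%:R / N%:R - \sum_(j < m.+1) t (c, j : nat)|
  <= (\sum_(j < m.+1) t (c, j : nat) + m.+1%:R) / N%:R.
Proof.
move=> N2 t0; set S := \sum_(j < _) _; set r := ring_step _ _.
have N0 : 0 < N%:R :> R by rewrite ltr0n (leq_trans _ N2).
have /andP[a0 _] := mesh_itv N2.
have S0 : 0 <= S by apply: sumr_ge0 => j _; exact: ltW.
have [h1 h2] : r%:R * mesh N <= S /\ S <= (r%:R + m.+1%:R) * mesh N.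
  rewrite /r /S /ring_step natr_sum; split.
    rewrite mulr_suml; apply: ler_sum => j _.
    by rewrite -ler_pdivlMr// truncn_le// divr_ge0// ltW.
  have -> : m.+1%:R = \sum_(j < m.+1) (1 : R) by rewrite sumr_const card_ord.
  rewrite -big_split mulr_suml /=.
  apply: ler_sum => j _; rewrite -ler_pdivrMr//; apply: ltW.
  by rewrite natr1; apply: truncnS_gt.
have A1 := mesh_ge N2; have A2 := mesh_mul_le N2.
have h1' : r%:R / N%:R <= S by apply: le_trans h1; rewrite ler_wpM2l.
have h2' : S * (1 - N%:R^-1) <= (r%:R + m.+1%:R) / N%:R.
  have /andP[_ q1] := inv_nat_itv N2.
  apply: (@le_trans _ _ ((r%:R + m.+1%:R) * mesh N * (1 - N%:R^-1))).
    by rewrite ler_wpM2r// subr_ge0 ltW.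
  by rewrite -mulrA ler_wpM2l// addr_ge0.
have i0 : 0 < N%:R^-1 :> R by rewrite invr_gt0.
have Si : 0 <= S / N%:R by rewrite divr_ge0// ltW.
have mi : 0 <= m%:R / N%:R :> R by rewrite divr_ge0// ltW.
move: h1' h2'; rewrite -!natr1 !mulrDl mulrBr mulr1 mul1r => h1' h2'.
by rewrite ler_norml; apply/andP; split; lra.
Qed.

Lemma positive_lower_bound (J : finType) (f : J -> R) : (forall j, 0 < f j) ->
  exists2 delta, 0 < delta & forall j, delta <= f j.
Proof.
move=> f0; exists (\big[Num.min/1]_j f j); first exact: lt_bigmin.
by move=> j; exact: bigmin_le_cond.
Qed.

End Meshes.

Section PathConvergence.
Context (R : realType) (k : nat) (t : clock k * nat -> R).
Context (y : cadlag R (discrete_topology (config k))).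
Hypothesis t_good : good_times t.
Hypothesis t_distinct : forall c c' r r', c != c' ->
  \sum_(m < r.+1) t (c, m : nat) <> \sum_(m < r'.+1) t (c', m : nat).
Hypothesis y_driven : driven_by t y.

(** The noise of the discrete process with parameter [1 / N] read off the waiting
    times of the limit process. *)
Definition coupled_noise N : noise k :=
  fun i => rings_at (gaps (mesh R N) t (i.1.1, i.2)) i.1.2.

Let t_pos := t_good.1.

Let ring_time_inj c c' m m' : ring_time t c m = ring_time t c' m' ->
  c = c' /\ m = m'.
Proof.
have [<-|ne] := eqVneq c c'; last by move=> /t_distinct; case/(_ ne).
move=> e; split=> //; have [lt|lt|//] := ltngtP m m'.
  by have := ring_time_lt t_pos c lt; rewrite e ltxx.
by have := ring_time_lt t_pos c lt; rewrite e ltxx.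
Qed.

Let ring_time_unbounded T : exists M, forall c, T < ring_time t c M.
Proof.
have ex c : exists m, T < ring_time t c m.
  have h1 : 0 < (1 : R) <= 1 by rewrite ltr01 lexx.
  have [m Tm] := good_endless c h1 t_good (Num.truncn T).+1; exists m.
  apply: (@lt_le_trans _ _ (Num.truncn T).+1%:R); first exact: truncnS_gt.
  apply: (@le_trans _ _ (ring_step (gaps 1 t c) m)%:R); first by rewrite ler_nat.
  rewrite /ring_step natr_sum; apply: ler_sum => j _.
  by rewrite /gaps divr1 truncn_le ltW// t_pos.
have [f fP] := choice ex; exists (\max_c f c)%N => c.
by apply: lt_le_trans (fP c) _; apply: ring_time_le => //; exact: leq_bigmax.
Qed.

(** On a bounded time interval finitely many distinct ring times are involved;
    their images on the grid converge to them, so for [N] large a tent time change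
    close to the identity carries one path to the other. *)
Lemma coupled_path_cvg :
  (fun N => step_path N (X (coupled_noise N) : nat -> discrete_topology (config k)))
    @ \oo --> y.
Proof.
apply/cvg_app_entourageP => B [[[T e] A] /= [e0 AE] AB].
have [M TM] := ring_time_unbounded T.
pose J := (clock k * 'I_M.+1)%type.
pose S (j : J) := ring_time t j.1 j.2.
pose t' N (j : J) : R := (ring_step (gaps (mesh R N) t j.1) j.2).+1%:R / N%:R.
have S_inj : injective S.
  by move=> [c m] [c' m'] /ring_time_inj /= [-> /val_inj ->].
(* A width for which the tents are disjoint and avoid 0. *)
pose sep (p : J * J) := if p.1 == p.2 then S p.1 else `|S p.1 - S p.2|.
have [delta delta0 sepP] : exists2 delta, 0 < delta & forall p, delta <= sep p.
  apply: positive_lower_bound => -[i j]; rewrite /sep /=.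
  case: eqVneq => [_|ij]; first exact: ring_time_gt0.
  by rewrite normr_gt0 subr_eq0 (inj_eq S_inj).
have S_ge j : delta <= S j by have := sepP (j, j); rewrite /sep eqxx.
have S_sep i j : i != j -> delta <= `|S i - S j|.
  by move=> ij; have := sepP (i, j); rewrite /sep (negbTE ij).
pose K := \sum_(j : J) (S j + j.2.+1%:R).
have close N : (2 <= N)%N -> \sum_j `|t' N j - S j| <= K / N%:R.
  by move=> N2; rewrite /K mulr_suml; apply: ler_sum => j _; exact: ring_step_dist.
near=> N; apply: AB.
have N2 : (2 <= N)%N by near: N; exact: nbhs_infty_ge.
have KN : K / N%:R < Num.min delta e.
  have m0 : 0 < Num.min delta e by rewrite lt_min delta0.
  have N0 : 0 < N%:R :> R by rewrite ltr0n (leq_trans _ N2).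
  rewrite ltr_pdivrMr// mulrC -ltr_pdivrMr//.
  apply: (@lt_le_trans _ _ (Num.truncn (K / Num.min delta e)).+1%:R).
    exact: truncnS_gt.
  by rewrite ler_nat; near: N; exact: nbhs_infty_ge.
have Kd : \sum_j `|t' N j - S j| < delta.
  by apply: le_lt_trans (close N N2) _; apply: lt_le_trans KN _; rewrite ge_min lexx.
have Ke : \sum_j `|t' N j - S j| < e.
  by apply: le_lt_trans (close N N2) _; apply: lt_le_trans KN _; rewrite ge_min lexx orbT.
have lamP := tent_change_time delta0 S_ge Kd.
exists (tent_change S (t' N) delta) => // s s0 sT; split.
  exact: le_lt_trans (tent_change_dist _ _ delta0 _) Ke.
rewrite /= /step_fun -(@trajectory_eq R k t y t_pos y_driven N (mesh R N) _ M T)//.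
- exact: entourage_refl.
- exact: leq_trans N2.
- by move=> c; apply: good_endless => //; exact: mesh_itv.
- move=> c m mM; have := tent_change_at (t' N) delta0 S_sep (c, Ordinal (mM : m < M.+1)%N).
  by rewrite /S /t' /=.
- by move=> c c' m m' _ _; exact: ring_time_inj.
Unshelve. all: by end_near. Qed.

End PathConvergence.

(** * Convergence in distribution *)
Section Truncation.
Context (R : realType) (k : nat).

Lemma X_eq (x x' : noise k) L :
  (forall p n b, (n < L)%N -> x (p, n, b) = x' (p, n, b)) ->
  forall n, (n <= L)%N -> X x n = X x' n.
Proof.
move=> xx'; elim=> // n IH nL; rewrite /= IH ?(ltnW nL)//.
have E b : (fun q => x (q, n, b)) = (fun q => x' (q, n, b)).
  by apply/funext => q; exact: xx'.
by rewrite /X_full_step /X_half_step !E.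
Qed.

Definition cut_noise L (g : {ffun clock k * 'I_L -> nat}) : noise k :=
  fun i => extend0 g (i.1.1, i.2) i.1.2.

Definition initial_noise (x : noise k) L : {ffun clock k * 'I_L -> nat} :=
  [ffun j : clock k * 'I_L => x (j.1.1, j.2 : nat, j.1.2)].

Definition path_of (N : nat) (x : noise k) :
    cadlag R (discrete_topology (config k)) :=
  step_path N (X x : nat -> discrete_topology (config k)).

(** The path up to time [T] depends only on the noise of the steps before
    [N * T]. *)
Lemma cut_path_cvg N (x : noise k) :
  path_of N (cut_noise (initial_noise x L)) @[L --> \oo] --> path_of N x.
Proof.
apply/cvg_app_entourageP => B [[[T e] A] /= [e0 AE] AB].
near=> L; apply: AB; exists id; first exact: time_change_id.
move=> s s0 sT; rewrite subrr normr0; split=> //=.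
rewrite /step_fun (@X_eq x (cut_noise (initial_noise x L)) L).
- exact: entourage_refl.
- move=> p n b nL; rewrite /cut_noise /= -[n]/(nat_of_ord (Ordinal nL)) extend0E.
  by rewrite ffunE.
apply: (@leq_trans (Num.truncn (N%:R * T))); last by near: L; exact: nbhs_infty_ge.
by apply: le_truncn; rewrite ler_wpM2l.
Unshelve. all: by end_near. Qed.

End Truncation.

Section NoiseFunctionals.
Context (R : realType) (k : nat).
Context (F : cadlag R (discrete_topology (config k)) -> R) (M : R).
Hypothesis F_cont : continuous F.
Hypothesis F_le : forall x, `|F x| <= M.

Definition noise_event d (T : measurableType d) (x : T -> noise k) L
    (g : {ffun clock k * 'I_L -> nat}) : set T :=
  [set w | forall j : clock k * 'I_L, x w (j.1.1, j.2 : nat, j.1.2) = g j].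

Let cut_cvg N (x : noise k) :
  F (path_of R N (cut_noise (initial_noise x L))) @[L --> \oo] --> F (path_of R N x).
Proof. by apply: continuous_cvg; [exact: F_cont|exact: cut_path_cvg]. Qed.

Let measurable_cut d (T : measurableType d) (x : T -> noise k) N L :
  (forall L (g : {ffun clock k * 'I_L -> nat}), measurable (noise_event x g)) ->
  measurable_fun setT (fun w => F (path_of R N (cut_noise (initial_noise (x w) L)))).
Proof.
move=> mx; exact: (measurable_string (U := fun (j : clock k * 'I_L) w =>
  x w (j.1.1, j.2 : nat, j.1.2)) (fun g => F (path_of R N (cut_noise g))) (mx L)).
Qed.

Lemma measurable_path_functional d (T : measurableType d) (x : T -> noise k) N :
  (forall L (g : {ffun clock k * 'I_L -> nat}), measurable (noise_event x g)) ->
  measurable_fun setT (fun w => F (path_of R N (x w))).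
Proof.
move=> mx; apply/measurable_EFinP.
rewrite (_ : _ \o _ = (fun w => limn_esup (fun L =>
    (F (path_of R N (cut_noise (initial_noise (x w) L))))%:E))).
  apply: measurable_fun_limn_esup => L; apply/measurable_EFinP.
  exact: measurable_cut.
apply/funext => w; apply/esym.
have h : (F (path_of R N (cut_noise (initial_noise (x w) L))))%:E @[L --> \oo] -->
    (F (path_of R N (x w)))%:E.
  by apply: cvg_EFin; [exact: nearW|exact: cut_cvg].
by have [_ ->] := cvg_limn_einf_sup h.
Qed.

Let cut_expectation d (T : measurableType d) (P : probability T R)
    (x : T -> noise k) N :
  (forall L (g : {ffun clock k * 'I_L -> nat}), measurable (noise_event x g)) ->
  ('E_P[fun w => F (path_of R N (cut_noise (initial_noise (x w) L)))]
    @[L --> \oo] --> 'E_P[fun w => F (path_of R N (x w))])%E.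
Proof.
move=> mx; apply: (@cvg_expectation_ae _ _ _ _ _ _ M) => [L|L w|].
- exact: measurable_cut.
- exact: F_le.
- by apply: aeW => w; exact: cut_cvg.
Qed.

(** The laws of all finite strings determine the expectations of functions of
    the noise cut at step [L], and then, by bounded convergence in [L], those of
    the functional of the whole path. *)
Lemma expectation_same_noise d1 (T1 : measurableType d1) (P1 : probability T1 R)
    d2 (T2 : measurableType d2) (P2 : probability T2 R)
    (x1 : T1 -> noise k) (x2 : T2 -> noise k) N :
  (forall L (g : {ffun clock k * 'I_L -> nat}), measurable (noise_event x1 g)) ->
  (forall L (g : {ffun clock k * 'I_L -> nat}), measurable (noise_event x2 g)) ->
  (forall L (g : {ffun clock k * 'I_L -> nat}),
     P1 (noise_event x1 g) = P2 (noise_event x2 g)) ->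
  ('E_P1[fun w => F (path_of R N (x1 w))] = 'E_P2[fun w => F (path_of R N (x2 w))])%E.
Proof.
move=> m1 m2 P12.
have c1 := @cut_expectation _ _ P1 x1 N m1; have := @cut_expectation _ _ P2 x2 N m2.
rewrite -(_ : (fun L => 'E_P1[fun w =>
   F (path_of R N (cut_noise (initial_noise (x1 w) L)))])%E =
  (fun L => 'E_P2[fun w =>
   F (path_of R N (cut_noise (initial_noise (x2 w) L)))])%E).
  by move=> c2; exact: cvg_unique c1 c2.
apply/funext => L.
exact: (expectation_string (F := fun g => F (path_of R N (cut_noise g)))
  (U1 := fun (j : clock k * 'I_L) w => x1 w (j.1.1, j.2 : nat, j.1.2))
  (U2 := fun (j : clock k * 'I_L) w => x2 w (j.1.1, j.2 : nat, j.1.2))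
  (m1 L) (m2 L) (P12 L) (fun g => F_le _)).
Qed.

End NoiseFunctionals.


Theorem proposition8p10 (R : realType) (k : nat) (hk : (1 <= k)%N)
  (dX : nat -> measure_display) (TX : forall N, measurableType (dX N))
  (PX : forall N, probability (TX N) R)
  (xi : forall N, label k * nat * bool -> {RV (PX N) >-> nat})
  (xi_law : forall N, (2 <= N)%N -> forall c (x : nat),
     distribution (PX N) (xi N c) [set x] =
     ((1 - N%:R^-1) * N%:R^-1 ^+ x)%:E)
  (xi_indep : forall N, (2 <= N)%N -> mutually_independent (xi N))
  (dY : measure_display) (TY : measurableType dY) (PY : probability TY R)
  (tau : clock k * nat -> {RV PY >-> R})
  (tau_law : forall c (B : set R), measurable B ->
     distribution PY (tau c) B = exponential_prob 1 B)
  (tau_indep : mutually_independent tau)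
  (Y : TY -> cadlag R (discrete_topology (config k)))
  (Y_meas : forall (t : R) (y : config k), 0 <= t -> measurable [set w | Y w t = y])
  (Y_driven : {ae PY, forall w, driven_by (fun c => tau c w) (Y w)}) :
  cvg_in_distribution PX
    (fun N w => step_path N
       (X (fun c => xi N c w) : nat -> discrete_topology (config k)))
    PY Y.
Proof.
move=> F F_cont [M F_le].
have [t [t_good t_tau t_meas]] := good_version tau_law tau_indep.
pose x N w : noise k := coupled_noise (t w) N.
have hinj (c : clock k) (m : nat) (c' : clock k) (m' : nat) :
    (c.1, m, c.2) = (c'.1, m', c'.2) -> c = c' /\ m = m'.
  by case: c c' => [p b] [p' b'] [-> -> ->].
(* The noise of the process and the coupled noise have the same law. *)
have xP N L (g : {ffun clock k * 'I_L -> nat}) : (2 <= N)%N ->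
    measurable (noise_event (x N) g) /\
    PY (noise_event (x N) g) = (string_mass N%:R^-1 g)%:E.
  move=> N2.
  rewrite (_ : noise_event _ _ = [set w | forall j : clock k * 'I_L,
      rings_at (gaps (mesh R N) (t w) j.1) j.2 = g j]).
    exact: (count_string_prob tau_law tau_indep g (mesh_itv R N2)
      (expR_meshN R N2) t_good t_tau t_meas).
  by apply/seteqP; split=> w H [[p b] i]; exact: (H ((p, b), i)).
have xiP N L (g : {ffun clock k * 'I_L -> nat}) : (2 <= N)%N ->
    measurable (noise_event (fun w c => xi N c w) g) /\
    PX N (noise_event (fun w c => xi N c w) g) = (string_mass N%:R^-1 g)%:E.
  move=> N2.
  have := @geometric_string_prob R (clock k) L _ _ (PX N) _ (xi N)
    (fun c n => (c.1, n, c.2)) N%:R^-1 g (xi_indep N N2) hinj (xi_law N N2).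
  by [].
(* The parameter 1 / N is in (0, 1) from N = 2 on. *)
rewrite -(cvg_shiftn 2).
have N2 N : (2 <= N + 2)%N by rewrite addn2.
rewrite (_ : (fun N => _) = (fun N => 'E_PY[fun w => F (path_of R (N + 2) (x (N + 2)%N w))])%E).
  apply: (@cvg_expectation_ae _ _ _ _ _ _ M).
  - move=> N; apply: measurable_path_functional => // L g.
    by have [] := xP (N + 2)%N L g (N2 N).
  - by move=> N w; exact: F_le.
  have dist := distinct_rings_ae tau_law tau_indep.
  near=> w.
  have tw : t w = tau^~ w by near: w.
  have c : path_of R N (x N w) @[N --> \oo] --> Y w.
    apply: coupled_path_cvg; first exact: t_good.
    - by rewrite tw; near: w.
    - by rewrite tw; near: w.
  rewrite (cvg_shiftn 2 (fun N => F (path_of R N (x N w)))).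
  by apply: continuous_cvg; [exact: F_cont|exact: c].
apply/funext => N.
apply: (expectation_same_noise F_cont F_le) => L g.
- by have [] := xiP (N + 2)%N L g (N2 N).
- by have [] := xP (N + 2)%N L g (N2 N).
- by have [_ ->] := xiP (N + 2)%N L g (N2 N); have [_ ->] := xP (N + 2)%N L g (N2 N).
Unshelve. all: by end_near. Qed.
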